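(* Let $k$ be a field, $A$ a $k$-algebra, $\mathcal C$ an $A$-coring, and let $M$ be a Galois right $\mathcal C$-comodule, $S=\mathrm{End}^{-\mathcal C}(M)$ and $\hat S=\mathrm{End}_{-A}(M)$. Suppose that $S\to\hat S$ is a split extension. Then: (1) If $M^*$ is projective as a right $S$-module (i.e., $M^*$ is a principal left comodule) and $\mathcal C$ is flat as a left $A$-module, then, for any left $\mathcal C$-comodule $V$ that is finitely generated projective as a left $A$-module, $\mathrm{Hom}^{\mathcal C-}(V,M^* )$ is a finitely generated projective right $S$-module. (2) If $M$ is projective as a left $S$-module (i.e., $M$ is a principal right comodule) and $\mathcal C$ is flat as a right $A$-module, then, for any right $\mathcal C$-comodule $W$ that is finitely generated projective as a right $A$-module, $\mathrm{Hom}^{-\mathcal C}(W,M)$ is a finitely generated projective left $S$-module.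
   Context: Algebras are associative and unital. An $A$-coring $\mathcal C$ is an $(A,A)$-bimodule with coassociative coproduct $\Delta_{\mathcal C}:\mathcal C\to\mathcal C\otimes_A\mathcal C$ and counit $\varepsilon_{\mathcal C}:\mathcal C\to A$ (bimodule maps). Right coactions are written $\varrho^M(m)=\sum m_{(0)}\otimes m_{(1)}\in M\otimes_A\mathcal C$. $\mathrm{Hom}^{-\mathcal C}$ (resp. $\mathrm{Hom}^{\mathcal C-}$) denotes colinear maps of right (resp. left) comodules, $\mathrm{End}_{-A}$ right $A$-linear endomorphisms. $S$ and $\hat S$ are rings under composition, $S\subseteq\hat S$; $M$ is a left $S$-module, $\mathrm{Hom}^{-\mathcal C}(M,N)$ is a right $S$-module ($fs=f\circ s$) and $\mathrm{Hom}^{-\mathcal C}(W,M)$ is a left $S$-module ($sf=s\circ f$). A right $\mathcal C$-comodule $M$ is Galois if it is finitely generated and projective as a right $A$-module and $\mathrm{Hom}^{-\mathcal C}(M,\mathcal C)\otimes_S M\to\mathcal C$, $f\otimes m\mapsto f(m)$, is an isomorphism of right $\mathcal C$-comodules ($\mathcal C$ a comodule via $\Delta_{\mathcal C}$). A Galois right (left) comodule is principal if it is projective as a left (right) module over its endomorphism ring. $M^*=\mathrm{Hom}_{-A}(M,A)$ is a left $\mathcal C$-comodule via ${}^{M^*}\!\varrho(\xi)=\sum_i\xi(e^i_{(0)})e^i_{(1)}\otimes\xi^i$, where $\{e^i\in M,\xi^i\in M^*\}$ is a finite dual basis of $M_A$, and a right $S$-module via $\xi s=\xi\circ s$ (this identifies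 $S$ with the left comodule endomorphism ring of $M^*$, with opposite composition as product, and $M^*$ is a Galois left comodule). $\mathrm{Hom}^{\mathcal C-}(V,M^* )$ is a right $S$-module via $(fs)(v)=f(v)s$. A ring extension $S\to R$ is split if there is an $(S,S)$-bimodule map $\sigma:R\to S$ with $\sigma(1_R)=1_S$. *)

(* Defs.v *)
From HB Require Import structures.
From mathcomp Require Import all_boot all_algebra generic_quotient boolp.

Set Implicit Arguments.
Unset Strict Implicit.
Unset Printing Implicit Defensive.

Import GRing.Theory.
Local Open Scope ring_scope.
Local Open Scope quotient_scope.

Section LinExt.
Variables (R : pzRingType) (M N : lmodType R).

Lemma lin_ext (f g : {linear M -> N}) : f =1 g -> f = g.
Proof.
case: f => f [[[f1 f2]] [f3]]; case: g => g [[[g1 g2]] [g3]] /= efg.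
have e : f = g by apply/funext.
subst g.
by rewrite (Prop_irrelevance f1 g1) (Prop_irrelevance f2 g2) (Prop_irrelevance f3 g3).
Qed.
End LinExt.

(* A right R-module is an lmodType over the converse ring R^c, so that        *)
(* (r : R^c) *: x stands for x r.                                             *)
(* The tensor product is the quotient of the free commutative monoid on M * N *)
(* (lists up to reordering) by the usual relations; opposites need not be     *)
(* added to the free monoid, since (- x, y) is opposite to (x, y) modulo      *)
(* these relations.                                                           *)
Section Tensor.
Variables (R : pzRingType) (M : lmodType R^c) (N : lmodType R).

Inductive tens_rel : seq (M * N) -> seq (M * N) -> Prop :=
| TensRefl s : tens_rel s s
| TensSym s t : tens_rel s t -> tens_rel t s
| TensTrans s t u : tens_rel s t -> tens_rel t u -> tens_rel s u
| TensCat s s' t t' :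
    tens_rel s s' -> tens_rel t t' -> tens_rel (s ++ t) (s' ++ t')
| TensCatC s t : tens_rel (s ++ t) (t ++ s)
| Tens0l y : tens_rel [:: (0, y)] [::]
| TensDl x x' y : tens_rel [:: (x + x', y)] [:: (x, y); (x', y)]
| TensDr x y y' : tens_rel [:: (x, y + y')] [:: (x, y); (x, y')]
| TensBal x (r : R) y : tens_rel [:: ((r : R^c) *: x, y)] [:: (x, r *: y)].

Definition tens_relb s t := `[< tens_rel s t >].

Lemma tens_relb_refl : reflexive tens_relb.
Proof. by move=> s; apply/asboolP/TensRefl. Qed.

Lemma tens_relb_sym : symmetric tens_relb.
Proof. by move=> s t; apply/asboolP/asboolP => /TensSym. Qed.

Lemma tens_relb_trans : transitive tens_relb.
Proof.
move=> t s u /asboolP st /asboolP tu; apply/asboolP; exact: TensTrans st tu.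
Qed.

Canonical tens_equiv :=
  EquivRel tens_relb tens_relb_refl tens_relb_sym tens_relb_trans.

Definition tensor : Type := {eq_quot tens_equiv}.
HB.instance Definition _ := Choice.on tensor.

Definition tens_class (s : seq (M * N)) : tensor := \pi_{eq_quot tens_equiv} s.
Definition tens_repr (t : tensor) : seq (M * N) :=
  repr (t : {eq_quot tens_equiv}).

Definition tens (x : M) (y : N) : tensor := tens_class [:: (x, y)].

Lemma tens_reprK t : tens_class (tens_repr t) = t.
Proof. exact: reprK. Qed.

Lemma tens_classP s t : tens_class s = tens_class t <-> tens_rel s t.
Proof.
split=> [/eqmodP /asboolP //|st]; by apply/eqmodP/asboolP.
Qed.

Lemma tens_repr_class s : tens_rel (tens_repr (tens_class s)) s.
Proof. by apply/tens_classP; rewrite tens_reprK. Qed.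

Definition tens_add (t u : tensor) := tens_class (tens_repr t ++ tens_repr u).
Definition tens_opp (t : tensor) :=
  tens_class [seq (- p.1, p.2) | p <- tens_repr t].

Lemma tens_addE s t : tens_add (tens_class s) (tens_class t) = tens_class (s ++ t).
Proof. by apply/tens_classP/TensCat; exact: tens_repr_class. Qed.

Lemma tens_addA : associative tens_add.
Proof.
move=> t u v; rewrite -(tens_reprK t) -(tens_reprK u) -(tens_reprK v).
by rewrite !tens_addE catA.
Qed.

Lemma tens_addC : commutative tens_add.
Proof. by move=> t u; apply/tens_classP/TensCatC. Qed.

Lemma tens_add0 : left_id (tens_class [::]) tens_add.
Proof. by move=> t; rewrite -(tens_reprK t) tens_addE. Qed.

Lemma tens_addN : left_inverse (tens_class [::]) tens_opp tens_add.
Proof.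
move=> t; rewrite -{2}(tens_reprK t) /tens_opp tens_addE.
elim: (tens_repr t) => [//|[x y] s IHs] /=; move: IHs; set l := map _ s => IHs.
rewrite -(cat1s _ s) -cat1s -!tens_addE (tens_addA (tens_class l)).
rewrite (tens_addC (tens_class l)) -(tens_addA _ (tens_class l)).
rewrite [tens_add (tens_class l) _]tens_addE IHs !tens_addE cats0 /=.
apply/tens_classP; apply: TensTrans (Tens0l y); rewrite -(addNr x).
exact/TensSym/TensDl.
Qed.

HB.instance Definition _ :=
  GRing.isZmodule.Build tensor tens_addA tens_addC tens_add0 tens_addN.

Lemma tens_classD s t : tens_class (s ++ t) = tens_class s + tens_class t.
Proof. by rewrite -tens_addE. Qed.

Lemma tensDl x x' y : tens (x + x') y = tens x y + tens x' y.
Proof. by rewrite -tens_classD; apply/tens_classP/TensDl. Qed.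

Lemma tensDr x y y' : tens x (y + y') = tens x y + tens x y'.
Proof. by rewrite -tens_classD; apply/tens_classP/TensDr. Qed.

Lemma tens_bal x (r : R) y : tens ((r : R^c) *: x) y = tens x (r *: y).
Proof. exact/tens_classP/TensBal. Qed.

Lemma tens0l y : tens 0 y = 0.
Proof. exact/tens_classP/Tens0l. Qed.

Lemma tens0r x : tens x 0 = 0.
Proof. by apply: (addIr (tens x 0)); rewrite -tensDr !add0r. Qed.

Lemma tens_suml I (s : seq I) (F : I -> M) y :
  tens (\sum_(i <- s) F i) y = \sum_(i <- s) tens (F i) y.
Proof.
by elim/big_rec2: _ => [|i x t _ <-]; rewrite ?tens0l // tensDl.
Qed.

Lemma tens_sumr I (s : seq I) x (F : I -> N) :
  tens x (\sum_(i <- s) F i) = \sum_(i <- s) tens x (F i).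
Proof.
by elim/big_rec2: _ => [|i y t _ <-]; rewrite ?tens0r // tensDr.
Qed.

Lemma tens_reprE t : t = \sum_(p <- tens_repr t) tens p.1 p.2.
Proof.
rewrite -{1}(tens_reprK t); elim: (tens_repr t) => [|[x y] s IHs].
  by rewrite big_nil.
by rewrite big_cons -cat1s tens_classD IHs.
Qed.

Lemma tens_ind (P : tensor -> Prop) :
  P 0 -> (forall t u, P t -> P u -> P (t + u)) -> (forall x y, P (tens x y)) ->
  forall t, P t.
Proof. by move=> P0 PD Pt t; rewrite (tens_reprE t); apply: big_ind. Qed.

Section Lift.
Variable G : zmodType.

Definition balanced (b : M -> N -> G) : Prop :=
  [/\ forall x x' y, b (x + x') y = b x y + b x' y,
      forall x y y', b x (y + y') = b x y + b x y' &
      forall x (r : R) y, b ((r : R^c) *: x) y = b x (r *: y)].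

(* Only meaningful when b is balanced: it is then the unique additive map     *)
(* sending tens x y to b x y (lemmas tliftE, tliftD and tens_ext).            *)
Definition tlift (b : M -> N -> G) (t : tensor) : G :=
  \sum_(p <- tens_repr t) b p.1 p.2.

Lemma tens_ext (f g : tensor -> G) :
  {morph f : t u / t + u} -> {morph g : t u / t + u} ->
  (forall x y, f (tens x y) = g (tens x y)) -> f =1 g.
Proof.
move=> fD gD fg; apply: tens_ind => [|t u ft gu|//].
- have f0 : f 0 = 0 by apply: (addIr (f 0)); rewrite -fD !add0r.
  by rewrite f0; apply: (addIr (g 0)); rewrite -gD !add0r.
- by rewrite fD gD ft gu.
Qed.

Variable b : M -> N -> G.
Hypothesis bP : balanced b.

Lemma tlift_rel s t : tens_rel s t ->
  \sum_(p <- s) b p.1 p.2 = \sum_(p <- t) b p.1 p.2.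
Proof.
have [bDl bDr bB] := bP.
elim=> {s t} [//|s t _ -> //|s t u _ -> _ -> //|s s' t t' _ e _ e'|s t|y|x x' y|x y y'|x r y].
- by rewrite !big_cat /= e e'.
- by rewrite !big_cat /= addrC.
- rewrite big_seq1 big_nil /=.
  by apply: (addIr (b 0 y)); rewrite -bDl !add0r.
- by rewrite big_seq1 big_cons big_seq1 /= bDl.
- by rewrite big_seq1 big_cons big_seq1 /= bDr.
- by rewrite !big_seq1 /= bB.
Qed.

Lemma tliftE x y : tlift b (tens x y) = b x y.
Proof.
by rewrite /tlift (tlift_rel (tens_repr_class _)) big_seq1.
Qed.

Lemma tliftD : {morph tlift b : t u / t + u}.
Proof.
move=> t u; rewrite /tlift -big_cat; apply: tlift_rel.
exact: tens_repr_class.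
Qed.

Lemma tlift0 : tlift b 0 = 0.
Proof. by apply: (addIr (tlift b 0)); rewrite -tliftD !add0r. Qed.

End Lift.
End Tensor.

Section TensorMap.
Variables (R : pzRingType) (M M' : lmodType R^c) (N N' : lmodType R).

Definition tensor_map (f : M -> M') (g : N -> N') : tensor M N -> tensor M' N' :=
  tlift (fun x y => tens (f x) (g y)).

Lemma tensor_map_bal (f : M -> M') (g : N -> N') : linear f -> linear g ->
  balanced (fun x y => tens (f x) (g y)).
Proof.
move=> fl gl.
have fD x x' : f (x + x') = f x + f x' by have := fl 1 x x'; rewrite !scale1r.
have gD y y' : g (y + y') = g y + g y' by have := gl 1 y y'; rewrite !scale1r.
split=> [x x' y|x y y'|x r y]; first by rewrite fD tensDl.
  by rewrite gD tensDr.
have f0 : f 0 = 0 by apply: (addIr (f 0)); rewrite -fD !add0r.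
have g0 : g 0 = 0 by apply: (addIr (g 0)); rewrite -gD !add0r.
have := fl r x 0; rewrite !addr0 f0 addr0 => ->.
by have := gl r y 0; rewrite !addr0 g0 addr0 => ->; rewrite tens_bal.
Qed.

Lemma tensor_mapE (f : M -> M') (g : N -> N') x y : linear f -> linear g ->
  tensor_map f g (tens x y) = tens (f x) (g y).
Proof. by move=> fl gl; exact: (tliftE (tensor_map_bal fl gl)). Qed.

Lemma tensor_mapD (f : M -> M') (g : N -> N') : linear f -> linear g ->
  {morph tensor_map f g : t u / t + u}.
Proof. by move=> fl gl; exact: (tliftD (tensor_map_bal fl gl)). Qed.

End TensorMap.

Lemma lin_id (R : pzRingType) (M : lmodType R) : linear (@id M).
Proof. by []. Qed.

Lemma linE (R : pzRingType) (M N : lmodType R) (f : {linear M -> N}) : linear f.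
Proof. exact: linearP. Qed.

Lemma lin_comp (R : pzRingType) (M N P : lmodType R) (f : N -> P) (g : M -> N) :
  linear f -> linear g -> linear (f \o g).
Proof. by move=> fl gl a x y; rewrite /= gl fl. Qed.

Lemma linD (R : pzRingType) (M N : lmodType R) (f : M -> N) :
  linear f -> {morph f : x y / x + y}.
Proof. by move=> fl x y; have := fl 1 x y; rewrite !scale1r. Qed.

Lemma lin0 (R : pzRingType) (M N : lmodType R) (f : M -> N) :
  linear f -> f 0 = 0.
Proof. by move=> /linD fD; apply: (addIr (f 0)); rewrite -fD !add0r. Qed.

Lemma linZ (R : pzRingType) (M N : lmodType R) (f : M -> N) a x :
  linear f -> f (a *: x) = a *: f x.
Proof. by move=> fl; have := fl a x 0; rewrite (lin0 fl) !addr0. Qed.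

Lemma lin_intro (R : pzRingType) (M N : lmodType R) (f : M -> N) :
  {morph f : x y / x + y} -> (forall a x, f (a *: x) = a *: f x) -> linear f.
Proof. by move=> fD fZ a x y; rewrite fD fZ. Qed.

Lemma morphD_sum (U V : zmodType) (f : U -> V) : {morph f : x y / x + y} ->
  forall I (s : seq I) (F : I -> U),
  f (\sum_(i <- s) F i) = \sum_(i <- s) f (F i).
Proof.
move=> fD I s F; have f0 : f 0 = 0 by apply: (addIr (f 0)); rewrite -fD !add0r.
exact: (big_morph f fD f0).
Qed.

Lemma tensor_map_comp (R : pzRingType) (M M' M'' : lmodType R^c)
    (N N' N'' : lmodType R) (f : M' -> M'') (f' : M -> M')
    (g : N' -> N'') (g' : N -> N') t :
  linear f -> linear f' -> linear g -> linear g' ->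
  tensor_map f g (tensor_map f' g' t) = tensor_map (f \o f') (g \o g') t.
Proof.
move=> fl fl' gl gl'.
apply: (@tens_ext _ _ _ _ (fun t => tensor_map f g (tensor_map f' g' t))) => [u v|u v|x y] /=.
- by rewrite !tensor_mapD.
- by rewrite tensor_mapD //; exact: lin_comp.
- by rewrite !tensor_mapE //; exact: lin_comp.
Qed.

Lemma tensor_map_ext (R : pzRingType) (M M' : lmodType R^c) (N N' : lmodType R)
    (f f' : M -> M') (g g' : N -> N') :
  f =1 f' -> g =1 g' -> tensor_map f g =1 tensor_map f' g'.
Proof. by move=> /funext -> /funext ->. Qed.

Lemma tensor_map_id (R : pzRingType) (M : lmodType R^c) (N : lmodType R) t :
  tensor_map (@id M) (@id N) t = t.
Proof.
apply: (@tens_ext _ _ _ _ _ id) => // [u v|x y].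
- by rewrite tensor_mapD //; exact: lin_id.
- by rewrite tensor_mapE //; exact: lin_id.
Qed.

Record bimodule (R T : pzRingType) := Bimodule {
  bimod_sort :> lmodType R;
  ract : bimod_sort -> T -> bimod_sort;
  ractDl : forall x y t, ract (x + y) t = ract x t + ract y t;
  ractDr : forall x s t, ract x (s + t) = ract x s + ract x t;
  ractM : forall x s t, ract x (s * t) = ract (ract x s) t;
  ract1 : forall x, ract x 1 = x;
  ractZ : forall r x t, ract (r *: x) t = r *: ract x t
}.

Definition rmod (R T : pzRingType) (X : bimodule R T) : Type := X.

Section RMod.
Variables (R T : pzRingType) (X : bimodule R T).
HB.instance Definition _ := GRing.Zmodule.copy (rmod X) (bimod_sort X).

Definition rmod_scale (t : T^c) (x : rmod X) : rmod X := ract (x : X) t.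

Lemma rmod_scaleA a b v : rmod_scale a (rmod_scale b v) = rmod_scale (a * b) v.
Proof. by rewrite /rmod_scale -ractM. Qed.
Lemma rmod_scale1 : left_id 1 rmod_scale.
Proof. exact: ract1. Qed.
Lemma rmod_scaleDr : right_distributive rmod_scale +%R.
Proof. by move=> a x y; exact: ractDl. Qed.
Lemma rmod_scaleDl v : {morph rmod_scale^~ v : a b / a + b}.
Proof. by move=> a b; exact: ractDr. Qed.

HB.instance Definition _ := GRing.Zmodule_isLmodule.Build T^c (rmod X)
  rmod_scaleA rmod_scale1 rmod_scaleDr rmod_scaleDl.
End RMod.

(* The two ways in which a tensor product inherits a module structure from a  *)
(* bimodule factor, as aliases of tensor.                                     *)
Definition rtensor (R T : pzRingType) (M : lmodType R^c) (X : bimodule R T) : Type :=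
  tensor M X.
Definition ltensor (R T : pzRingType) (X : bimodule R T) (N : lmodType T) : Type :=
  tensor (rmod X) N.

Section RTensor.
Variables (R T : pzRingType) (M : lmodType R^c) (X : bimodule R T).
HB.instance Definition _ := GRing.Zmodule.copy (rtensor M X) (tensor M X).

Definition rtensor_scale (t : T^c) (u : rtensor M X) : rtensor M X :=
  tensor_map id (fun x : X => ract x t) u.

Lemma ract_lin t : linear (fun x : X => ract x t).
Proof. by move=> a x y; rewrite ractDl ractZ. Qed.

Lemma rtensor_scaleE t x y : rtensor_scale t (tens x y) = tens x (ract y t).
Proof. by rewrite /rtensor_scale tensor_mapE //; exact: ract_lin. Qed.

Lemma rtensor_scaleDr : right_distributive rtensor_scale +%R.
Proof. by move=> a x y; rewrite /rtensor_scale tensor_mapD //; exact: ract_lin. Qed.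

Lemma rtensor_scaleA a b v :
  rtensor_scale a (rtensor_scale b v) = rtensor_scale (a * b) v.
Proof.
move: v; apply: tens_ext => [u v|u v|x y]; rewrite ?rtensor_scaleDr //.
by rewrite !rtensor_scaleE -ractM.
Qed.

Lemma rtensor_scale1 : left_id 1 rtensor_scale.
Proof.
apply: (@tens_ext _ _ _ _ _ id) => [u v|//|x y]; rewrite ?rtensor_scaleDr //.
by rewrite rtensor_scaleE ract1.
Qed.

Lemma rtensor_scaleDl v : {morph rtensor_scale^~ v : a b / a + b}.
Proof.
move=> a b; move: v; apply: (@tens_ext _ _ _ _ _ (fun v => _ + _)) => [u v|u v|x y].
- by rewrite rtensor_scaleDr.
- by rewrite !rtensor_scaleDr addrACA.
- by rewrite !rtensor_scaleE ractDr tensDr.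
Qed.

HB.instance Definition _ := GRing.Zmodule_isLmodule.Build T^c (rtensor M X)
  rtensor_scaleA rtensor_scale1 rtensor_scaleDr rtensor_scaleDl.
End RTensor.

Section LTensor.
Variables (R T : pzRingType) (X : bimodule R T) (N : lmodType T).
HB.instance Definition _ := GRing.Zmodule.copy (ltensor X N) (tensor (rmod X) N).

Definition ltensor_scale (r : R) (u : ltensor X N) : ltensor X N :=
  tensor_map (fun x : rmod X => (r *: (x : X)) : rmod X) id u.

Lemma scale_rlin r : linear (fun x : rmod X => (r *: (x : X)) : rmod X).
Proof.
move=> a x y; apply: (etrans (scalerDr r (ract (x : X) a) (y : X))).
by rewrite -ractZ.
Qed.

Lemma ltensor_scaleE r x y :
  ltensor_scale r (tens x y) = tens ((r *: (x : X)) : rmod X) y.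
Proof. by rewrite /ltensor_scale tensor_mapE //; exact: scale_rlin. Qed.

Lemma ltensor_scaleDr : right_distributive ltensor_scale +%R.
Proof. by move=> a x y; rewrite /ltensor_scale tensor_mapD //; exact: scale_rlin. Qed.

Lemma ltensor_scaleA a b v :
  ltensor_scale a (ltensor_scale b v) = ltensor_scale (a * b) v.
Proof.
move: v; apply: tens_ext => [u v|u v|x y]; rewrite ?ltensor_scaleDr //.
by rewrite !ltensor_scaleE scalerA.
Qed.

Lemma ltensor_scale1 : left_id 1 ltensor_scale.
Proof.
apply: (@tens_ext _ _ _ _ _ id) => [u v|//|x y]; rewrite ?ltensor_scaleDr //.
by rewrite ltensor_scaleE scale1r.
Qed.

Lemma ltensor_scaleDl v : {morph ltensor_scale^~ v : a b / a + b}.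
Proof.
move=> a b; move: v; apply: (@tens_ext _ _ _ _ _ (fun v => _ + _)) => [u v|u v|x y].
- by rewrite ltensor_scaleDr.
- by rewrite !ltensor_scaleDr addrACA.
- by rewrite !ltensor_scaleE scalerDl -tensDl.
Qed.

HB.instance Definition _ := GRing.Zmodule_isLmodule.Build R (ltensor X N)
  ltensor_scaleA ltensor_scale1 ltensor_scaleDr ltensor_scaleDl.
End LTensor.

Section Assoc.
Variables (R T : pzRingType) (M : lmodType R^c) (X : bimodule R T) (N : lmodType T).

(* The canonical map (m (x) x) (x) n |-> m (x) (x (x) n). *)
Definition tassoc : tensor (rtensor M X) N -> tensor M (ltensor X N) :=
  tlift (fun (u : rtensor M X) (n : N) =>
    tlift (fun (m : M) (x : X) => tens m (tens (x : rmod X) n : ltensor X N)) u).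

Lemma tassoc_bal1 n :
  balanced (fun (m : M) (x : X) => tens m (tens (x : rmod X) n : ltensor X N)).
Proof.
split=> [x x' y|x y y'|x r y]; first by rewrite tensDl.
  by rewrite -tensDr; congr tens; rewrite -tensDl.
rewrite tens_bal; congr tens.
by rewrite -[r *: _]/(ltensor_scale r (tens (y : rmod X) n)) ltensor_scaleE.
Qed.

Lemma tassoc_bal : balanced (fun (u : rtensor M X) (n : N) =>
  tlift (fun (m : M) (x : X) => tens m (tens (x : rmod X) n : ltensor X N)) u).
Proof.
split=> [u u' n|u n n'|u r n].
- exact: (tliftD (tassoc_bal1 n)).
- move: u; apply: (@tens_ext _ _ _ _ _ (fun u => _ + _)) => [u v|u v|m x].
  + exact: (tliftD (tassoc_bal1 _)).
  + by rewrite !(tliftD (tassoc_bal1 _)) addrACA.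
  + by rewrite !(tliftE (tassoc_bal1 _)) -tensDr -tensDr.
- move: u; apply: (@tens_ext _ _ _ _ (fun u => _)) => [u v|u v|m x].
  + rewrite -(tliftD (tassoc_bal1 n)); congr tlift.
    exact: (scalerDr (r : T^c) (u : rtensor M X) v).
  + exact: (tliftD (tassoc_bal1 _)).
  + rewrite -[X in tlift _ X]/(rtensor_scale r (tens m x)) rtensor_scaleE.
    rewrite !(tliftE (tassoc_bal1 _)); congr tens.
    by rewrite -tens_bal.
Qed.

Lemma tassocE m x n :
  tassoc (tens (tens m x : rtensor M X) n) = tens m (tens (x : rmod X) n : ltensor X N).
Proof. by rewrite /tassoc (tliftE tassoc_bal) (tliftE (tassoc_bal1 _)). Qed.

Lemma tassocD : {morph tassoc : t u / t + u}.
Proof. exact: (tliftD tassoc_bal). Qed.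
End Assoc.

Section ModuleNotions.
Variable R : pzRingType.

Definition projective (P : lmodType R) : Prop :=
  forall (N N' : lmodType R) (g : {linear N -> N'}) (f : {linear P -> N'}),
    (forall y, exists x, g x = y) ->
    exists h : {linear P -> N}, forall x, g (h x) = f x.

Definition fin_generated (P : lmodType R) : Prop :=
  exists (n : nat) (e : 'I_n -> P),
    forall x, exists a : 'I_n -> R, x = \sum_(i < n) a i *: e i.

Definition fg_projective (P : lmodType R) : Prop :=
  fin_generated P /\ projective P.

Definition flat_left (N : lmodType R) : Prop :=
  forall (X Y : lmodType R^c) (f : {linear X -> Y}),
    injective f -> injective (tensor_map f (@id N)).

Definition flat_right (M : lmodType R^c) : Prop :=
  forall (X Y : lmodType R) (f : {linear X -> Y}),
    injective f -> injective (tensor_map (@id M) f).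

End ModuleNotions.

Definition split_extension (S R : pzRingType) (i : {rmorphism S -> R}) : Prop :=
  exists sigma : {additive R -> S},
    [/\ forall s x, sigma (i s * x) = s * sigma x,
        forall x s, sigma (x * i s) = sigma x * s &
        sigma 1 = 1].

Definition lhom (R : pzRingType) (M N : lmodType R) : Type := {linear M -> N}.

Section LHom.
Variables (R : pzRingType) (M N : lmodType R).
Implicit Types f g : lhom M N.

HB.instance Definition _ := gen_eqMixin (lhom M N).
HB.instance Definition _ := gen_choiceMixin (lhom M N).

Definition lhom_add f g : lhom M N := (f : {linear M -> N}) \+ (g : {linear M -> N}).
Definition lhom_opp f : lhom M N := \- (f : {linear M -> N}).
Definition lhom0 : lhom M N := \0 : {linear M -> N}.

Fact lhom_addA : associative lhom_add.
Proof. by move=> f g h; apply: lin_ext => x /=; rewrite addrA. Qed.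
Fact lhom_addC : commutative lhom_add.
Proof. by move=> f g; apply: lin_ext => x /=; rewrite addrC. Qed.
Fact lhom_add0 : left_id lhom0 lhom_add.
Proof. by move=> f; apply: lin_ext => x /=; rewrite add0r. Qed.
Fact lhom_addN : left_inverse lhom0 lhom_opp lhom_add.
Proof. by move=> f; apply: lin_ext => x /=; rewrite addNr. Qed.

HB.instance Definition _ :=
  GRing.isZmodule.Build (lhom M N) lhom_addA lhom_addC lhom_add0 lhom_addN.

Lemma lhom_sumE I (s : seq I) (F : I -> lhom M N) x :
  (\sum_(i <- s) F i : lhom M N) x = \sum_(i <- s) F i x.
Proof. by elim/big_rec2: _ => [//|i y t _ <-]. Qed.
End LHom.

Definition endo (R : pzRingType) (M : lmodType R) : Type := lhom M M.

Section Endo.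
Variables (R : pzRingType) (M : lmodType R).
HB.instance Definition _ := GRing.Zmodule.copy (endo M) (lhom M M).

Definition endo1 : endo M := idfun : {linear M -> M}.
Definition endo_comp (f g : endo M) : endo M :=
  (f : {linear M -> M}) \o (g : {linear M -> M}).

Fact endo_compA : associative endo_comp.
Proof. by move=> f g h; apply: lin_ext. Qed.
Fact endo_comp1f : left_id endo1 endo_comp.
Proof. by move=> f; apply: lin_ext. Qed.
Fact endo_compf1 : right_id endo1 endo_comp.
Proof. by move=> f; apply: lin_ext. Qed.
Fact endo_compDl : left_distributive endo_comp +%R.
Proof. by move=> f g h; apply: lin_ext. Qed.
Fact endo_compDr : right_distributive endo_comp +%R.
Proof. by move=> f g h; apply: lin_ext => x /=; rewrite linearD. Qed.

HB.instance Definition _ := GRing.Zmodule_isPzRing.Build (endo M)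
  endo_compA endo_comp1f endo_compf1 endo_compDl endo_compDr.
End Endo.

(* M^* for a right A-module M; (A^c)^o is A as a right module over itself. *)
Definition dual (A : pzRingType) (M : lmodType A^c) : Type := lhom M (A^c)^o.

Section Dual.
Variables (A : pzRingType) (M : lmodType A^c).
HB.instance Definition _ := GRing.Zmodule.copy (dual M) (lhom M (A^c)^o).

Definition dual_eval (xi : dual M) (m : M) : A := xi m.

Definition dual_scale_fun (a : A) (xi : dual M) : M -> (A^c)^o :=
  fun m => a * dual_eval xi m.

Fact dual_scale_lin a xi : linear (dual_scale_fun a xi).
Proof.
move=> b x y; rewrite /dual_scale_fun /dual_eval linearP mulrDr.
by congr (_ + _); exact: (@mulrA A a (dual_eval xi x) b).
Qed.
HB.instance Definition _ a xi :=
  GRing.isLinear.Build A^c M (A^c)^o _ (dual_scale_fun a xi) (dual_scale_lin a xi).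
Definition dual_scale a xi : dual M := dual_scale_fun a xi : {linear M -> (A^c)^o}.

Fact dual_scaleA a b xi : dual_scale a (dual_scale b xi) = dual_scale (a * b) xi.
Proof. by apply: lin_ext => x; exact: (@mulrA A). Qed.
Fact dual_scale1 : left_id 1 dual_scale.
Proof. by move=> xi; apply: lin_ext => x; exact: (@mul1r A). Qed.
Fact dual_scaleDr : right_distributive dual_scale +%R.
Proof. by move=> a xi zeta; apply: lin_ext => x; exact: (@mulrDr A). Qed.
Fact dual_scaleDl xi : {morph dual_scale^~ xi : a b / a + b}.
Proof. by move=> a b; apply: lin_ext => x; exact: (@mulrDl A). Qed.

HB.instance Definition _ := GRing.Zmodule_isLmodule.Build A (dual M)
  dual_scaleA dual_scale1 dual_scaleDr dual_scaleDl.
End Dual.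

Record dual_basis (A : pzRingType) (M : lmodType A^c) := DualBasis {
  db_size : nat;
  db_vec : 'I_db_size -> M;
  db_form : 'I_db_size -> dual M;
  db_expand : forall m : M,
    m = \sum_(i < db_size) (dual_eval (db_form i) m : A^c) *: db_vec i
}.
Arguments db_vec {A M} d i.
Arguments db_form {A M} d i.

Record coring (A : pzRingType) := Coring {
  coring_sort :> bimodule A A;
  comul : coring_sort -> tensor (rmod coring_sort) coring_sort;
  counit : coring_sort -> A;
  comul_llin : linear (comul : coring_sort -> ltensor coring_sort coring_sort);
  comul_rlin :
    linear (comul : rmod coring_sort -> rtensor (rmod coring_sort) coring_sort);
  counit_llin : linear (counit : coring_sort -> A^o);
  counit_rlin : linear (counit : rmod coring_sort -> (A^c)^o);
  comul_coassoc : forall c : coring_sort,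
    tassoc (tensor_map
        (comul : rmod coring_sort -> rtensor (rmod coring_sort) coring_sort) id
        (comul c)) =
    tensor_map id (comul : coring_sort -> ltensor coring_sort coring_sort) (comul c);
  comul_counitl : forall c : coring_sort,
    tlift (fun (x : rmod coring_sort) (y : coring_sort) => counit x *: y)
      (comul c) = c;
  comul_counitr : forall c : coring_sort,
    tlift (fun (x : rmod coring_sort) (y : coring_sort) =>
      ract (x : coring_sort) (counit y)) (comul c) = c
}.

Section Comodules.
Variables (A : pzRingType) (C : coring A).

Record rcomodule := RComodule {
  rcom_sort :> lmodType A^c;
  rcoact : {linear rcom_sort -> rtensor rcom_sort C};
  rcoact_coassoc : forall m : rcom_sort,
    tassoc (tensor_map rcoact id (rcoact m)) =
    tensor_map id (@comul A C : C -> ltensor C C) (rcoact m);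
  rcoact_counit : forall m : rcom_sort,
    tlift (fun (x : rcom_sort) (c : C) => (counit c : A^c) *: x) (rcoact m) = m
}.

Record lcomodule := LComodule {
  lcom_sort :> lmodType A;
  lcoact : {linear lcom_sort -> ltensor C lcom_sort};
  lcoact_coassoc : forall v : lcom_sort,
    tassoc (tensor_map (@comul A C : rmod C -> rtensor (rmod C) C) id (lcoact v)) =
    tensor_map id lcoact (lcoact v);
  lcoact_counit : forall v : lcom_sort,
    tlift (fun (c : rmod C) (x : lcom_sort) => counit (c : C) *: x) (lcoact v) = v
}.

Record rcom_hom (M N : rcomodule) := RComHom {
  rcom_fun :> {linear M -> N};
  rcom_funP : forall m, tensor_map rcom_fun (@id C) (rcoact M m) = rcoact N (rcom_fun m)
}.

Record lcom_hom (V W : lcomodule) := LComHom {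
  lcom_fun :> {linear V -> W};
  lcom_funP : forall v,
    tensor_map (@id (rmod C)) lcom_fun (lcoact V v) = lcoact W (lcom_fun v)
}.

Lemma rcom_ext (M N : rcomodule) (f g : rcom_hom M N) : f =1 g -> f = g.
Proof.
case: f g => [f fP] [g gP] /= /lin_ext e; subst g.
by rewrite (Prop_irrelevance fP gP).
Qed.

Lemma lcom_ext (V W : lcomodule) (f g : lcom_hom V W) : f =1 g -> f = g.
Proof.
case: f g => [f fP] [g gP] /= /lin_ext e; subst g.
by rewrite (Prop_irrelevance fP gP).
Qed.
End Comodules.

Lemma tensor_mapDl (R : pzRingType) (M M' : lmodType R^c) (N N' : lmodType R)
    (f f' : {linear M -> M'}) (g : {linear N -> N'}) t :
  tensor_map (f \+ f') g t = tensor_map f g t + tensor_map f' g t.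
Proof.
have fl := linE f; have fl' := linE f'; have gl := linE g; have al := linE (f \+ f').
apply: (@tens_ext _ _ _ _ _ (fun t => tensor_map f g t + tensor_map f' g t)) => [u v|u v|x y].
- exact: tensor_mapD.
- by rewrite !tensor_mapD // addrACA.
- by rewrite !tensor_mapE // tensDl.
Qed.

Lemma tensor_mapDr (R : pzRingType) (M M' : lmodType R^c) (N N' : lmodType R)
    (f : {linear M -> M'}) (g g' : {linear N -> N'}) t :
  tensor_map f (g \+ g') t = tensor_map f g t + tensor_map f g' t.
Proof.
have fl := linE f; have gl := linE g; have gl' := linE g'; have al := linE (g \+ g').
apply: (@tens_ext _ _ _ _ _ (fun t => tensor_map f g t + tensor_map f g' t)) => [u v|u v|x y].
- exact: tensor_mapD.
- by rewrite !tensor_mapD // addrACA.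
- by rewrite !tensor_mapE // tensDr.
Qed.

Lemma tensor_map0l (R : pzRingType) (M M' : lmodType R^c) (N N' : lmodType R)
    (g : {linear N -> N'}) t : tensor_map (\0 : M -> M') g t = 0.
Proof.
have gl := linE g; have zl := linE (\0 : {linear M -> M'}).
apply: (@tens_ext _ _ _ _ _ (fun=> 0)) => [u v|u v|x y].
- exact: tensor_mapD.
- by rewrite addr0.
- by rewrite tensor_mapE // tens0l.
Qed.

Lemma tensor_map0r (R : pzRingType) (M M' : lmodType R^c) (N N' : lmodType R)
    (f : {linear M -> M'}) t : tensor_map f (\0 : N -> N') t = 0.
Proof.
have fl := linE f; have zl := linE (\0 : {linear N -> N'}).
apply: (@tens_ext _ _ _ _ _ (fun=> 0)) => [u v|u v|x y].
- exact: tensor_mapD.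
- by rewrite addr0.
- by rewrite tensor_mapE // tens0r.
Qed.

(* Writing S for rcom_hom M M (with composition as product), rcom_hom W M is  *)
(* canonically a left S-module. A type has at most one canonical module       *)
(* structure, so the other S-modules are aliases: rcom_homR M N is            *)
(* Hom^{-C}(M, N) as a right S-module, lendmod M is M as a left S-module, and *)
(* dualR M is M^* as a right S-module (an lmodType over S^c).                 *)
Section RComHom.
Variables (A : pzRingType) (C : coring A).

Section Zmod.
Variables M N : rcomodule C.
Implicit Types f g : rcom_hom M N.

HB.instance Definition _ := gen_eqMixin (rcom_hom M N).
HB.instance Definition _ := gen_choiceMixin (rcom_hom M N).

Fact rcom_add_subproof f g m :
  tensor_map (f \+ g) (@id C) (rcoact M m) = rcoact N ((f \+ g) m).
Proof. by rewrite (tensor_mapDl f g idfun) !rcom_funP /= linearD. Qed.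
Definition rcom_add f g : rcom_hom M N := RComHom (rcom_add_subproof f g).

Fact rcom_zero_subproof m :
  tensor_map (\0 : M -> N) (@id C) (rcoact M m) = rcoact N ((\0 : M -> N) m).
Proof. by rewrite (tensor_map0l _ idfun) /= linear0. Qed.
Definition rcom_zero : rcom_hom M N := RComHom rcom_zero_subproof.

Fact rcom_opp_subproof f m :
  tensor_map (\- f) (@id C) (rcoact M m) = rcoact N ((\- f) m).
Proof.
apply: (addIr (tensor_map f (@id C) (rcoact M m))).
rewrite -(tensor_mapDl (\- f) f idfun) rcom_funP /= linearN addNr.
rewrite -[RHS](tensor_map0l N (idfun : {linear C -> C}) (rcoact M m)).
by apply: tensor_map_ext => // x /=; rewrite addNr.
Qed.
Definition rcom_opp f : rcom_hom M N := RComHom (rcom_opp_subproof f).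

Fact rcom_addA : associative rcom_add.
Proof. by move=> f g h; apply: rcom_ext => x /=; rewrite addrA. Qed.
Fact rcom_addC : commutative rcom_add.
Proof. by move=> f g; apply: rcom_ext => x /=; rewrite addrC. Qed.
Fact rcom_add0 : left_id rcom_zero rcom_add.
Proof. by move=> f; apply: rcom_ext => x /=; rewrite add0r. Qed.
Fact rcom_addN : left_inverse rcom_zero rcom_opp rcom_add.
Proof. by move=> f; apply: rcom_ext => x /=; rewrite addNr. Qed.

HB.instance Definition _ :=
  GRing.isZmodule.Build (rcom_hom M N) rcom_addA rcom_addC rcom_add0 rcom_addN.
End Zmod.

Fact rcom_comp_subproof (M N P : rcomodule C) (f : rcom_hom N P) (g : rcom_hom M N) m :
  tensor_map (f \o g) (@id C) (rcoact M m) = rcoact P ((f \o g) m).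
Proof.
rewrite /= -rcom_funP -rcom_funP tensor_map_comp //; exact: linE.
Qed.
Definition rcom_comp (M N P : rcomodule C) (f : rcom_hom N P) (g : rcom_hom M N) :
  rcom_hom M P := RComHom (rcom_comp_subproof f g).

Fact rcom_id_subproof (M : rcomodule C) m :
  tensor_map (@idfun M) (@id C) (rcoact M m) = rcoact M (idfun m).
Proof. exact: tensor_map_id. Qed.
Definition rcom_id (M : rcomodule C) : rcom_hom M M := RComHom (@rcom_id_subproof M).

Section Ring.
Variable M : rcomodule C.

Fact rcom_compA : associative (@rcom_comp M M M).
Proof. by move=> f g h; apply: rcom_ext. Qed.
Fact rcom_comp1f : left_id (rcom_id M) (@rcom_comp M M M).
Proof. by move=> f; apply: rcom_ext. Qed.
Fact rcom_compf1 : right_id (rcom_id M) (@rcom_comp M M M).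
Proof. by move=> f; apply: rcom_ext. Qed.
Fact rcom_compDl : left_distributive (@rcom_comp M M M) +%R.
Proof. by move=> f g h; apply: rcom_ext. Qed.
Fact rcom_compDr : right_distributive (@rcom_comp M M M) +%R.
Proof. by move=> f g h; apply: rcom_ext => x /=; rewrite linearD. Qed.

HB.instance Definition _ := GRing.Zmodule_isPzRing.Build (rcom_hom M M)
  rcom_compA rcom_comp1f rcom_compf1 rcom_compDl rcom_compDr.
End Ring.

Section LeftModule.
Variables W M : rcomodule C.

Fact rcom_scaleA (s t : rcom_hom M M) (f : rcom_hom W M) :
  rcom_comp s (rcom_comp t f) = rcom_comp (s * t) f.
Proof. exact: rcom_ext. Qed.
Fact rcom_scale1 : left_id 1 (@rcom_comp W M M).
Proof. by move=> f; apply: rcom_ext. Qed.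
Fact rcom_scaleDr : right_distributive (@rcom_comp W M M) +%R.
Proof. by move=> s f g; apply: rcom_ext => x /=; rewrite linearD. Qed.
Fact rcom_scaleDl f : {morph (@rcom_comp W M M)^~ f : s t / s + t}.
Proof. by move=> s t; apply: rcom_ext. Qed.

HB.instance Definition _ := GRing.Zmodule_isLmodule.Build (rcom_hom M M)
  (rcom_hom W M) rcom_scaleA rcom_scale1 rcom_scaleDr rcom_scaleDl.
End LeftModule.

Definition rcom_homR (M N : rcomodule C) : Type := rcom_hom M N.

Section RightModule.
Variables M N : rcomodule C.
HB.instance Definition _ := GRing.Zmodule.copy (rcom_homR M N) (rcom_hom M N).

Definition rcom_scaler (s : (rcom_hom M M)^c) (f : rcom_homR M N) : rcom_homR M N :=
  rcom_comp f s.

Fact rcom_scalerA s t f :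
  rcom_scaler s (rcom_scaler t f) = rcom_scaler (s * t) f.
Proof. exact: rcom_ext. Qed.
Fact rcom_scaler1 : left_id 1 rcom_scaler.
Proof. by move=> f; apply: rcom_ext. Qed.
Fact rcom_scalerDr : right_distributive rcom_scaler +%R.
Proof. by move=> s f g; apply: rcom_ext. Qed.
Fact rcom_scalerDl f : {morph rcom_scaler^~ f : s t / s + t}.
Proof. by move=> s t; apply: rcom_ext => x /=; rewrite linearD. Qed.

HB.instance Definition _ := GRing.Zmodule_isLmodule.Build (rcom_hom M M)^c
  (rcom_homR M N) rcom_scalerA rcom_scaler1 rcom_scalerDr rcom_scalerDl.
End RightModule.

Section EndAction.
Variable M : rcomodule C.

Definition end_incl (s : rcom_hom M M) : endo M := rcom_fun s.

Fact end_incl_additive : zmod_morphism end_incl.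
Proof. by move=> s t; apply: lin_ext. Qed.
Fact end_incl_multiplicative : monoid_morphism end_incl.
Proof. by split=> [|s t]; apply: lin_ext. Qed.
HB.instance Definition _ := GRing.isZmodMorphism.Build (rcom_hom M M) (endo M)
  end_incl end_incl_additive.
HB.instance Definition _ := GRing.isMonoidMorphism.Build (rcom_hom M M) (endo M)
  end_incl end_incl_multiplicative.

Definition lendmod : Type := M.
HB.instance Definition _ := GRing.Zmodule.copy lendmod M.

Definition lend_scale (s : rcom_hom M M) (m : lendmod) : lendmod := s m.

Fact lend_scaleA s t m : lend_scale s (lend_scale t m) = lend_scale (s * t) m.
Proof. by []. Qed.
Fact lend_scale1 : left_id 1 lend_scale.
Proof. by []. Qed.
Fact lend_scaleDr : right_distributive lend_scale +%R.
Proof. by move=> s x y; exact: linearD. Qed.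
Fact lend_scaleDl m : {morph lend_scale^~ m : s t / s + t}.
Proof. by []. Qed.

HB.instance Definition _ := GRing.Zmodule_isLmodule.Build (rcom_hom M M) lendmod
  lend_scaleA lend_scale1 lend_scaleDr lend_scaleDl.

Definition lend_ract (m : lendmod) (a : A) : lendmod := (a : A^c) *: (m : M).

Fact lend_ractDl x y t : lend_ract (x + y) t = lend_ract x t + lend_ract y t.
Proof. exact: (@scalerDr A^c M). Qed.
Fact lend_ractDr x s t : lend_ract x (s + t) = lend_ract x s + lend_ract x t.
Proof. exact: (@scalerDl A^c M). Qed.
Fact lend_ractM x s t : lend_ract x (s * t) = lend_ract (lend_ract x s) t.
Proof. by rewrite /lend_ract scalerA. Qed.
Fact lend_ract1 x : lend_ract x 1 = x.
Proof. exact: (@scale1r A^c M). Qed.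
Fact lend_ractZ (s : rcom_hom M M) x t : lend_ract (s *: x) t = s *: lend_ract x t.
Proof. exact: (esym (linZ (t : A^c) (x : M) (linE s))). Qed.

Definition lend_bimod : bimodule (rcom_hom M M) A :=
  Bimodule lend_ractDl lend_ractDr lend_ractM lend_ract1 lend_ractZ.

Definition dualR : Type := dual M.
HB.instance Definition _ := GRing.Zmodule.copy dualR (dual M).

Definition dualR_scale (s : (rcom_hom M M)^c) (xi : dualR) : dualR :=
  (xi : {linear M -> (A^c)^o}) \o (s : rcom_hom M M).

Fact dualR_scaleA s t xi :
  dualR_scale s (dualR_scale t xi) = dualR_scale (s * t) xi.
Proof. exact: lin_ext. Qed.
Fact dualR_scale1 : left_id 1 dualR_scale.
Proof. by move=> xi; apply: lin_ext. Qed.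
Fact dualR_scaleDr : right_distributive dualR_scale +%R.
Proof. by move=> s xi zeta; apply: lin_ext. Qed.
Fact dualR_scaleDl xi : {morph dualR_scale^~ xi : s t / s + t}.
Proof. by move=> s t; apply: lin_ext => x /=; rewrite linearD. Qed.

HB.instance Definition _ := GRing.Zmodule_isLmodule.Build (rcom_hom M M)^c dualR
  dualR_scaleA dualR_scale1 dualR_scaleDr dualR_scaleDl.
End EndAction.
End RComHom.

Lemma tassoc_map (R T : pzRingType) (M M' : lmodType R^c) (X X' : bimodule R T)
    (N N' : lmodType T) (f : M -> M') (h : rtensor M X -> rtensor M' X') (k : ltensor X N -> ltensor X' N')
    (h' : X -> X') (h'' : rmod X -> rmod X') (g : N -> N') u :
  linear f -> linear (h' : X -> X') -> linear (h'' : rmod X -> rmod X') -> linear g ->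
  linear (h : rtensor M X -> rtensor M' X') -> linear (k : ltensor X N -> ltensor X' N') ->
  h' =1 h'' -> h =1 tensor_map f h' -> k =1 tensor_map h'' g ->
  tassoc (tensor_map h g u) = tensor_map f k (tassoc u).
Proof.
move=> fl h'l h''l gl hl kl e he ke.
apply: (@tens_ext _ _ _ _ (fun u => tassoc (tensor_map h g u))
          (fun u => tensor_map f k (tassoc u))) => [v w|v w|v n].
- by rewrite tensor_mapD // tassocD.
- by rewrite tassocD tensor_mapD.
- rewrite tensor_mapE // he.
  move: v; apply: (@tens_ext _ _ _ _ (fun v => tassoc (tens (tensor_map f h' v : rtensor _ _) (g n)))
     (fun v => tensor_map f k (tassoc (tens (v : rtensor _ _) n)))) => [v w|v w|m x].
  + by rewrite tensor_mapD // tensDl tassocD.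
  + by rewrite tensDl tassocD tensor_mapD.
  + rewrite tensor_mapE // !tassocE tensor_mapE //; congr tens.
    by rewrite ke tensor_mapE // e.
Qed.

Section Galois.
Variables (A : pzRingType) (C : coring A).

Lemma comulD : {morph @comul A C : x y / x + y}.
Proof. exact: (linD (@comul_llin A C)). Qed.
Lemma counitD : {morph @counit A C : x y / x + y}.
Proof. exact: (linD (@counit_llin A C)). Qed.

Definition comulr : rmod C -> rtensor (rmod C) C := @comul A C.
HB.instance Definition _ :=
  GRing.isLinear.Build A^c (rmod C) (rtensor (rmod C) C) _ comulr (@comul_rlin A C).

Definition coring_rcomodule : rcomodule C :=
  @RComodule A C (rmod C) comulr (@comul_coassoc A C) (@comul_counitr A C).

Section TensorRComodule.
Variables (M : rcomodule C) (X : lmodType (rcom_hom M M)^c).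
Local Notation XM := (rtensor X (lend_bimod M)).

Definition tens_at (x : X) (m : M) : XM := tens x (m : lend_bimod M).

Lemma tens_at_lin x : linear (tens_at x).
Proof.
apply: lin_intro => [m m'|a m]; first exact: tensDr.
by rewrite -[RHS]/(rtensor_scale a (tens x (m : lend_bimod M))) rtensor_scaleE.
Qed.

(* x (x) m |-> sum (x (x) m_(0)) (x) m_(1) *)
Definition trcoact : XM -> rtensor XM C :=
  tlift (fun (x : X) (m : lend_bimod M) =>
    tensor_map (tens_at x) (@id C) (rcoact M (m : M)) : rtensor XM C).

Lemma trcoact_bal : balanced (fun (x : X) (m : lend_bimod M) =>
    tensor_map (tens_at x) (@id C) (rcoact M (m : M)) : rtensor XM C).
Proof.
have Tl := tens_at_lin; have il := @lin_id A C.
have tD z := tensor_mapD (Tl z) il; have tE z y c := tensor_mapE y c (Tl z) il.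
split=> [x x' m|x m m'|x s m].
- move: (rcoact M _) => u.
  apply: (@tens_ext _ _ _ _ _ (fun u => _ + _)) => [v w|v w|y c].
  + exact: tD.
  + by rewrite !tD; exact: addrACA.
  + by rewrite !tE -tensDl; congr tens; exact: tensDl.
- by rewrite -tD -(linearD (rcoact M)).
- have Tx := Tl x; have -> : s *: m = (s : rcom_hom M M) m by [].
  rewrite -rcom_funP tensor_map_comp //; last exact: linE.
  by apply: tensor_map_ext => // y; exact: tens_bal.
Qed.

Lemma trcoactE x m : trcoact (tens x (m : lend_bimod M)) =
  tensor_map (tens_at x) (@id C) (rcoact M (m : M)).
Proof. exact: (tliftE trcoact_bal). Qed.

Lemma trcoactD : {morph trcoact : t u / t + u}.
Proof. exact: (tliftD trcoact_bal). Qed.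

Lemma tensor_map_rlin (N N' : lmodType A^c) (f : N -> N') : linear f ->
  linear (tensor_map f (@id C) : rtensor N C -> rtensor N' C).
Proof.
move=> fl; have il := @lin_id A C.
apply: lin_intro => [u v|a u]; first exact: tensor_mapD.
rewrite -[LHS]/(tensor_map f (@id C) (tensor_map id (fun x : C => ract x a) u)).
rewrite -[RHS]/(tensor_map id (fun x : C => ract x a) (tensor_map f (@id C) u)).
have al := @ract_lin _ _ C a; have iM := @lin_id _ N; have iM' := @lin_id _ N'.
by rewrite !tensor_map_comp.
Qed.

Lemma trcoact_lin : linear trcoact.
Proof.
apply: lin_intro => [|a]; first exact: trcoactD.
apply: tens_ext => [u v|u v|x m].
- by rewrite -trcoactD -(@scalerDr A^c XM).
- by rewrite trcoactD (@scalerDr A^c).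
- have -> : a *: (tens x m : XM) = tens x (ract m a) by exact: rtensor_scaleE.
  rewrite !trcoactE.
  have -> : ract m a = (a : A^c) *: (m : M) :> M by [].
  by rewrite (linZ _ _ (linE (rcoact M))) (linZ _ _ (tensor_map_rlin (tens_at_lin x))).
Qed.
HB.instance Definition _ :=
  GRing.isLinear.Build A^c XM (rtensor XM C) _ trcoact trcoact_lin.

Lemma trcoact_coassoc u :
  tassoc (tensor_map trcoact id (trcoact u)) =
  tensor_map id (@comul A C : C -> ltensor C C) (trcoact u).
Proof.
have Tl := tens_at_lin; have il := @lin_id A C; have tl := trcoact_lin.
have cl := @comul_llin A C; have iX := @lin_id _ XM.
move: u; apply: (@tens_ext _ _ _ _ (fun u => tassoc (tensor_map trcoact id (trcoact u)))
  (fun u => tensor_map id (@comul A C : C -> ltensor C C) (trcoact u))) => [u v|u v|x m].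
- by rewrite trcoactD tensor_mapD // tassocD.
- by rewrite trcoactD tensor_mapD.
- have Tx := Tl x; rewrite trcoactE tensor_map_comp // tensor_map_comp //.
  rewrite -[RHS](@tensor_map_comp _ _ _ _ _ _ _ (tens_at x) id id (@comul A C : C -> ltensor C C)) //.
  rewrite -rcoact_coassoc.
  rewrite -(@tassoc_map _ _ _ _ C C _ _ (tens_at x) (tensor_map (tens_at x) (@id C)) id id id id) //.
  + rewrite tensor_map_comp //; [|exact: tensor_map_rlin|exact: linE].
    by congr tassoc; apply: tensor_map_ext => // y; exact: trcoactE.
  + exact: tensor_map_rlin.
  + by move=> v; rewrite tensor_map_id.
Qed.

Lemma trcoact_counit u :
  tlift (fun (x : XM) (c : C) => (counit c : A^c) *: x) (trcoact u) = u.
Proof.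
have Tl := tens_at_lin; have il := @lin_id A C.
have cb (N : lmodType A^c) : balanced (fun (x : N) (c : C) => (counit c : A^c) *: x).
  split=> [y y' c|y c c'|y a c]; first exact: scalerDr.
    by rewrite counitD; exact: scalerDl.
  by rewrite scalerA (linZ a c (@counit_llin A C)).
move: u; apply: (@tens_ext _ _ _ _ (fun u => tlift _ (trcoact u)) id) => // [u v|x m].
  by rewrite trcoactD (tliftD (cb XM)).
rewrite trcoactE -[in RHS](rcoact_counit (m : M)) -[RHS]/(tens_at x _).
move: (rcoact M _); apply: (@tens_ext _ _ _ _
  (fun w => tlift _ (tensor_map (tens_at x) id w))
  (fun w => tens_at x (tlift _ w))) => [v w|v w|y c].
- by rewrite (tensor_mapD (Tl x) il) (tliftD (cb XM)).
- by rewrite (tliftD (cb M)) (linD (Tl x)).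
- by rewrite (tensor_mapE _ _ (Tl x) il) (tliftE (cb XM)) (tliftE (cb M)) (linZ _ _ (Tl x)).
Qed.

Definition tensor_rcomodule : rcomodule C :=
  @RComodule A C XM trcoact trcoact_coassoc trcoact_counit.
End TensorRComodule.

Section GaloisMap.
Variable M : rcomodule C.
Local Notation HM := (rcom_homR M coring_rcomodule).

(* f (x) m |-> f(m) *)
Definition galois_fun : tensor_rcomodule HM -> coring_rcomodule :=
  tlift (fun (f : HM) (m : lend_bimod M) => f (m : M)).

Lemma galois_bal : balanced (fun (f : HM) (m : lend_bimod M) => f (m : M)).
Proof. by split=> [f g m|f m m'|f s m] //; exact: linearD. Qed.

Lemma galois_funE (f : HM) (m : M) :
  galois_fun (tens f (m : lend_bimod M)) = f m.
Proof. exact: (tliftE galois_bal). Qed.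

Lemma galois_lin : linear galois_fun.
Proof.
apply: lin_intro => [|a]; first exact: (tliftD galois_bal).
apply: (@tens_ext _ _ _ _ (fun u => galois_fun ((a : A^c) *: (u : tensor_rcomodule HM)))
  (fun u => (a : A^c) *: galois_fun u)) => [u v|u v|f m].
- by rewrite -(tliftD galois_bal) -(@scalerDr A^c (tensor_rcomodule HM)).
- by rewrite -(@scalerDr A^c coring_rcomodule); congr (_ *: _); exact: (tliftD galois_bal).
- have -> : a *: (tens f m : tensor_rcomodule HM) = tens f (ract m a).
    exact: rtensor_scaleE.
  by rewrite !galois_funE; exact: (linZ a (m : M) (linE (rcom_fun f))).
Qed.
HB.instance Definition _ := GRing.isLinear.Build A^c (tensor_rcomodule HM)
  coring_rcomodule _ galois_fun galois_lin.

Lemma galois_colin u :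
  tensor_map galois_fun (@id C) (rcoact (tensor_rcomodule HM) u) =
  rcoact coring_rcomodule (galois_fun u).
Proof.
have il := @lin_id A C; have gl := galois_lin.
move: u; apply: (@tens_ext _ _ _ _ (fun u => tensor_map galois_fun (@id C) (rcoact (tensor_rcomodule HM) u))
   (fun u => rcoact coring_rcomodule (galois_fun u))) => [u v|u v|f m].
- by rewrite -tensor_mapD //; congr tensor_map; exact: trcoactD.
- by rewrite -(linearD (rcoact coring_rcomodule)); apply: (congr1 (rcoact coring_rcomodule)); exact: (tliftD galois_bal).
- rewrite galois_funE -rcom_funP.
  rewrite -[rcoact _ _]/(trcoact (tens f m)) trcoactE tensor_map_comp //.
  + by apply: tensor_map_ext => // y; exact: galois_funE.
  + exact: tens_at_lin.
Qed.

Definition galois_map : rcom_hom (tensor_rcomodule HM) coring_rcomodule :=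
  RComHom galois_colin.
End GaloisMap.

Definition rcom_iso (M N : rcomodule C) (f : rcom_hom M N) : Prop :=
  exists g : rcom_hom N M, cancel f g /\ cancel g f.

Definition galois (M : rcomodule C) : Prop :=
  fg_projective M /\ rcom_iso (galois_map M).
End Galois.

Section DualComodule.
Variables (A : pzRingType) (C : coring A).

Section Contract.
Variables (M : lmodType A^c) (N : lmodType A).

(* m (x) n |-> xi(m) n *)
Definition contract (xi : dual M) : tensor M N -> N :=
  tlift (fun (m : M) (n : N) => dual_eval xi m *: n).

Lemma contract_bal xi : balanced (fun (m : M) (n : N) => dual_eval xi m *: n).
Proof.
split=> [x x' y|x y y'|x r y]; last by rewrite /dual_eval linearZ scalerA.
  by rewrite /dual_eval linearD scalerDl.
exact: scalerDr.
Qed.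

Lemma contractE xi m n : contract xi (tens m n) = dual_eval xi m *: n.
Proof. exact: (tliftE (contract_bal xi)). Qed.
Lemma contractD xi : {morph contract xi : t u / t + u}.
Proof. exact: (tliftD (contract_bal xi)). Qed.
End Contract.

Section Coaction.
Variables (M : rcomodule C) (b : dual_basis M).
Let e := db_vec b.
Let xi := db_form b.

(* m |-> sum zeta(m_(0)) m_(1) *)
Definition dcoef (zeta : dual M) (m : M) : C := contract zeta (rcoact M m).

Lemma dual_expand (zeta : dual M) :
  zeta = \sum_(i < db_size b) dual_eval zeta (e i) *: xi i.
Proof.
apply: lin_ext => m; rewrite [X in zeta X](db_expand b m).
rewrite (linear_sum zeta).
set F := fun i => dual_eval zeta (e i) *: xi i.
rewrite -[RHS]/((\sum_(i < db_size b) (F i : lhom M (A^c)^o) : lhom M (A^c)^o) m).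
rewrite lhom_sumE; apply: eq_bigr => i _.
by rewrite linearZ.
Qed.

Lemma contract_ract zeta (a : A) (u : rtensor M C) :
  contract zeta ((a : A^c) *: u) = ract (contract zeta u) a.
Proof.
move: u; apply: (@tens_ext _ _ _ _ (fun u => contract zeta ((a : A^c) *: (u : rtensor M C)))
  (fun u => ract (contract zeta u) a)) => [u v|u v|m c].
- by rewrite (@scalerDr A^c (rtensor M C)) contractD.
- by rewrite contractD ractDl.
- rewrite -[X in contract _ X]/(rtensor_scale a (tens m c)) rtensor_scaleE.
  by rewrite !contractE ractZ.
Qed.

Lemma dcoef_rlin zeta : linear (dcoef zeta : M -> rmod C).
Proof.
apply: lin_intro => [m m'|a m]; first by rewrite /dcoef linearD contractD.
by rewrite /dcoef linearZ; exact: contract_ract.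
Qed.

Lemma dcoef_llin m : linear (fun zeta : dual M => dcoef zeta m).
Proof.
move=> a z z'; rewrite /dcoef; move: (rcoact M m).
apply: (@tens_ext _ _ _ _ _ (fun u => a *: contract z u + contract z' u)) => [u v|u v|x c].
- exact: contractD.
- by rewrite !contractD scalerDr addrACA.
- rewrite !contractE scalerA -scalerDl; congr (_ *: _).
Qed.

Definition dcoact (zeta : dual M) : ltensor C (dual M) :=
  \sum_(i < db_size b) tens (dcoef zeta (e i) : rmod C) (xi i).

Lemma dcoact_lin : linear dcoact.
Proof.
move=> a z z'; rewrite /dcoact scaler_sumr -big_split; apply: eq_bigr => i _ /=.
rewrite (dcoef_llin (e i)).
have -> : a *: (tens (dcoef z (e i) : rmod C) (xi i) : ltensor C (dual M)) =
  tens ((a *: dcoef z (e i)) : rmod C) (xi i) by exact: ltensor_scaleE.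
exact: tensDl.
Qed.
HB.instance Definition _ :=
  GRing.isLinear.Build A (dual M) (ltensor C (dual M)) _ dcoact dcoact_lin.

Lemma contract_comul zeta (u : tensor M C) :
  comul (contract zeta u) =
  contract zeta (tensor_map id (@comul A C : C -> ltensor C C) u).
Proof.
have cl := @comul_llin A C; have iM := @lin_id _ M.
move: u; apply: (@tens_ext _ _ _ _ (fun u => comul (contract zeta u))
   (fun u => contract zeta (tensor_map id (@comul A C : C -> ltensor C C) u)))
  => [u v|u v|m c].
- by rewrite contractD comulD.
- by rewrite tensor_mapD // contractD.
- by rewrite tensor_mapE // !contractE (linZ _ _ cl).
Qed.

Lemma contract_assoc zeta (u : tensor (rtensor M C) C) :
  contract zeta (tassoc u) =
  tensor_map (contract zeta : rtensor M C -> rmod C) (@id C) u.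
Proof.
have kl : linear (contract zeta : rtensor M C -> rmod C).
  by apply: lin_intro => [v w|a v]; [exact: contractD | exact: contract_ract].
have iC := @lin_id _ C.
move: u; apply: (@tens_ext _ _ _ _ (fun u => contract zeta (tassoc u))) => [u v|u v|w c].
- by rewrite tassocD contractD.
- exact: tensor_mapD.
- rewrite tensor_mapE //; move: w.
  apply: (@tens_ext _ _ _ _ (fun w => contract zeta (tassoc (tens (w : rtensor M C) c)))
    (fun w => tens (contract zeta w : rmod C) c)) => [u v|u v|m x].
  + by rewrite tensDl tassocD contractD.
  + by rewrite contractD tensDl.
  + rewrite tassocE !contractE.
    exact: ltensor_scaleE.
Qed.

Lemma comul_dcoef zeta m :
  comul (dcoef zeta m) =
  tensor_map (dcoef zeta : M -> rmod C) (@id C) (rcoact M m).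
Proof.
have kl : linear (contract zeta : rtensor M C -> rmod C).
  by apply: lin_intro => [v w|a v]; [exact: contractD | exact: contract_ract].
rewrite /dcoef contract_comul -rcoact_coassoc contract_assoc tensor_map_comp //.
exact: linE.
Qed.

Lemma dcoef_expand zeta (u : tensor M C) :
  tensor_map (dcoef zeta : M -> rmod C) (@id C) u =
  \sum_(i < db_size b) tens (dcoef zeta (e i) : rmod C) (contract (xi i) u).
Proof.
have kl := dcoef_rlin zeta; have iC := @lin_id _ C.
move: u; apply: (@tens_ext _ _ _ _ _ (fun u => \sum_(i < db_size b) _)) => [u v|u v|m c].
- exact: tensor_mapD.
- by rewrite -big_split; apply: eq_bigr => i _ /=; rewrite contractD tensDr.
- rewrite tensor_mapE // [X in dcoef zeta X](db_expand b m).
  rewrite (morphD_sum (linD kl)) tens_suml; apply: eq_bigr => i _.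
  by rewrite (linZ _ _ kl) tens_bal contractE.
Qed.

Lemma dcoact_coassoc zeta :
  tassoc (tensor_map (@comul A C : rmod C -> rtensor (rmod C) C) id (dcoact zeta)) =
  tensor_map id dcoact (dcoact zeta).
Proof.
have rl := @comul_rlin A C; have iD := @lin_id _ (dual M).
have iC := @lin_id _ (rmod C); have dl := dcoact_lin.
rewrite {1}/dcoact (morphD_sum (tensor_mapD rl iD)) (morphD_sum (@tassocD _ _ _ _ _)).
transitivity (\sum_(j < db_size b) \sum_(i < db_size b)
   tens (dcoef zeta (e i) : rmod C)
     (tens (dcoef (xi i) (e j) : rmod C) (xi j) : ltensor C (dual M))).
  apply: eq_bigr => j _.
  rewrite tensor_mapE // comul_dcoef dcoef_expand tens_suml.
  rewrite (morphD_sum (@tassocD _ _ _ _ _)); apply: eq_bigr => i _.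
  exact: tassocE.
rewrite exchange_big /= {2}/dcoact (morphD_sum (tensor_mapD iC dl)).
apply: eq_bigr => i _; rewrite tensor_mapE // -tens_sumr //.
Qed.

Lemma dcoact_counit zeta :
  tlift (fun (c : rmod C) (x : dual M) => counit (c : C) *: x) (dcoact zeta) = zeta.
Proof.
have cb : balanced (fun (c : rmod C) (x : dual M) => counit (c : C) *: x).
  split=> [c c' x|c x x'|c a x]; last by rewrite scalerA (@linZ A^c (rmod C) (A^c)^o _ a c (@counit_rlin A C)).
    by rewrite counitD scalerDl.
  exact: scalerDr.
rewrite (morphD_sum (tliftD cb)) [RHS]dual_expand; apply: eq_bigr => i _.
rewrite (tliftE cb); congr (_ *: _).
rewrite /dcoef -[in RHS](rcoact_counit (e i)).
have ul : balanced (fun (x : M) (c : C) => (counit c : A^c) *: x).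
  split=> [y y' c|y c c'|y a c]; first exact: scalerDr.
    by rewrite counitD; exact: scalerDl.
  by rewrite scalerA (linZ a c (@counit_llin A C)).
apply: (@tens_ext _ _ _ _ (fun w => counit (contract zeta w))
  (fun w => dual_eval zeta (tlift _ w))) => [u v|u v|m c].
- by rewrite contractD counitD.
- by rewrite (tliftD ul); exact: linearD.
- rewrite (tliftE ul) contractE (linZ _ _ (@counit_llin A C)).
  by rewrite /dual_eval linearZ.
Qed.

(* M^* as a left comodule, through a dual basis of M as a right A-module:     *)
(* zeta |-> sum_i zeta(e^i_(0)) e^i_(1) (x) xi^i.                             *)
Definition dual_comodule : lcomodule C :=
  @LComodule A C (dual M) dcoact dcoact_coassoc dcoact_counit.
End Coaction.
End DualComodule.

Section LComHom.
Variables (A : pzRingType) (C : coring A).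

Section Zmod.
Variables V W : lcomodule C.
Implicit Types f g : lcom_hom V W.

HB.instance Definition _ := gen_eqMixin (lcom_hom V W).
HB.instance Definition _ := gen_choiceMixin (lcom_hom V W).

Fact lcom_add_subproof f g v :
  tensor_map (@id (rmod C)) (f \+ g) (lcoact V v) = lcoact W ((f \+ g) v).
Proof. by rewrite (tensor_mapDr idfun f g) !lcom_funP /= linearD. Qed.
Definition lcom_add f g : lcom_hom V W := LComHom (lcom_add_subproof f g).

Fact lcom_zero_subproof v :
  tensor_map (@id (rmod C)) (\0 : V -> W) (lcoact V v) = lcoact W ((\0 : V -> W) v).
Proof. by rewrite (tensor_map0r _ idfun) /= linear0. Qed.
Definition lcom_zero : lcom_hom V W := LComHom lcom_zero_subproof.

Fact lcom_opp_subproof f v :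
  tensor_map (@id (rmod C)) (\- f) (lcoact V v) = lcoact W ((\- f) v).
Proof.
apply: (addIr (tensor_map (@id (rmod C)) f (lcoact V v))).
rewrite -(tensor_mapDr idfun (\- f) f) lcom_funP /= linearN addNr.
rewrite -[RHS](tensor_map0r W (idfun : {linear rmod C -> rmod C}) (lcoact V v)).
by apply: tensor_map_ext => // x /=; rewrite addNr.
Qed.
Definition lcom_opp f : lcom_hom V W := LComHom (lcom_opp_subproof f).

Fact lcom_addA : associative lcom_add.
Proof. by move=> f g h; apply: lcom_ext => x /=; rewrite addrA. Qed.
Fact lcom_addC : commutative lcom_add.
Proof. by move=> f g; apply: lcom_ext => x /=; rewrite addrC. Qed.
Fact lcom_add0 : left_id lcom_zero lcom_add.
Proof. by move=> f; apply: lcom_ext => x /=; rewrite add0r. Qed.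
Fact lcom_addN : left_inverse lcom_zero lcom_opp lcom_add.
Proof. by move=> f; apply: lcom_ext => x /=; rewrite addNr. Qed.

HB.instance Definition _ :=
  GRing.isZmodule.Build (lcom_hom V W) lcom_addA lcom_addC lcom_add0 lcom_addN.
End Zmod.

(* Hom^{C-}(V, M^* ) as a right S-module: (f s)(v) = f(v) s. *)
Section HomDual.
Variables (V : lcomodule C) (M : rcomodule C) (b : dual_basis M).
Local Notation Md := (dual_comodule b).

Definition lcom_hom_dual : Type := lcom_hom V Md.
HB.instance Definition _ := GRing.Zmodule.copy lcom_hom_dual (lcom_hom V Md).

Definition dual_act (s : rcom_hom M M) (zeta : dual M) : dual M :=
  ((s : (rcom_hom M M)^c) *: (zeta : dualR M) : dualR M).

Lemma dual_act_lin s : linear (dual_act s).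
Proof. by move=> a x y; apply: lin_ext. Qed.

Lemma dcoact_act s zeta :
  tensor_map (@id (rmod C)) (dual_act s) (dcoact b zeta) = dcoact b (dual_act s zeta).
Proof.
have il := @lin_id _ (rmod C); have sl := dual_act_lin s.
rewrite /dcoact (morphD_sum (tensor_mapD il sl)).
transitivity (\sum_(j < db_size b) \sum_(i < db_size b)
   tens (dcoef zeta (db_vec b j) : rmod C)
        (dual_eval (db_form b j) (s (db_vec b i)) *: db_form b i)).
  apply: eq_bigr => j _; rewrite tensor_mapE //.
  by rewrite (dual_expand b (dual_act s _)) tens_sumr.
rewrite exchange_big; apply: eq_bigr => i _ /=.
have -> : dcoef (dual_act s zeta) (db_vec b i) = dcoef zeta (s (db_vec b i)).
  rewrite /dcoef -rcom_funP; move: (rcoact M _) => u.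
  have il' := @lin_id _ C; have sl' := linE (rcom_fun s).
  apply: (@tens_ext _ _ _ _ _ (fun u => contract zeta (tensor_map s id u)))
    => [v w|v w|m c].
  - exact: contractD.
  - by rewrite tensor_mapD // contractD.
  - by rewrite tensor_mapE // !contractE.
rewrite [X in dcoef zeta X](db_expand b).
rewrite (morphD_sum (linD (dcoef_rlin zeta))) tens_suml; apply: eq_bigr => j _.
by rewrite (linZ _ _ (dcoef_rlin zeta)) tens_bal.
Qed.

Definition lcom_dual_fun (s : rcom_hom M M) (f : lcom_hom_dual) : V -> Md :=
  fun v => dual_act s (f v).

Fact lcom_dual_lin s f : linear (lcom_dual_fun s f).
Proof. by move=> a x y; rewrite /lcom_dual_fun linearP (dual_act_lin s). Qed.
HB.instance Definition _ s f :=
  GRing.isLinear.Build A V Md _ (lcom_dual_fun s f) (lcom_dual_lin s f).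

Fact lcom_dual_subproof s f v :
  tensor_map (@id (rmod C)) (lcom_dual_fun s f) (lcoact V v) =
  lcoact Md (lcom_dual_fun s f v).
Proof.
have il := @lin_id _ (rmod C); have sl := dual_act_lin s.
have fl := linE (lcom_fun f).
rewrite -[RHS]dcoact_act -[dcoact b _](lcom_funP f) tensor_map_comp //.
Qed.

Definition lcom_dual_scale (s : (rcom_hom M M)^c) (f : lcom_hom_dual) :
  lcom_hom_dual := LComHom (lcom_dual_subproof s f).

Fact lcom_dual_scaleA s t f :
  lcom_dual_scale s (lcom_dual_scale t f) = lcom_dual_scale (s * t) f.
Proof. by apply: lcom_ext => v; apply: lin_ext. Qed.
Fact lcom_dual_scale1 : left_id 1 lcom_dual_scale.
Proof. by move=> f; apply: lcom_ext => v; apply: lin_ext. Qed.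
Fact lcom_dual_scaleDr : right_distributive lcom_dual_scale +%R.
Proof. by move=> s f g; apply: lcom_ext => v; apply: lin_ext. Qed.
Fact lcom_dual_scaleDl f : {morph lcom_dual_scale^~ f : s t / s + t}.
Proof.
by move=> s t; apply: lcom_ext => v; apply: lin_ext => x /=; exact: (linearD (f v)).
Qed.

HB.instance Definition _ := GRing.Zmodule_isLmodule.Build (rcom_hom M M)^c
  lcom_hom_dual lcom_dual_scaleA lcom_dual_scale1 lcom_dual_scaleDr lcom_dual_scaleDl.
End HomDual.
End LComHom.

(* A finitely generated projective right module has a finite dual basis, so   *)
(* quantifying over dual bases of such a module is never vacuous.             *)
Lemma fg_projective_dual_basis (A : pzRingType) (M : lmodType A^c) :
  fg_projective M -> exists b : dual_basis M, True.
Proof.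
case=> [[n [e eP]] Mproj].
pose F : lmodType A^c := {ffun 'I_n -> (A^c)^o}.
pose p (a : F) : M := \sum_(i < n) (a i : A^c) *: e i.
have pl : linear p.
  move=> a x y; rewrite /p scaler_sumr -big_split; apply: eq_bigr => i _ /=.
  by rewrite !ffunE scalerDl scalerA.
pose pL := GRing.isLinear.Build A^c F M _ p pl.
pose P : {linear F -> M} := HB.pack p pL.
have [|h hP] := Mproj F M P idfun.
  move=> y; have [a ya] := eP y; exists [ffun i => a i].
  by rewrite /= /p ya; apply: eq_bigr => i _; rewrite ffunE.
have xl i : linear (fun m : M => h m i : (A^c)^o).
  by move=> a x y; rewrite linearP !ffunE.
pose X i : dual M := (HB.pack (fun m : M => h m i : (A^c)^o)
   (GRing.isLinear.Build A^c M (A^c)^o _ _ (xl i)) : {linear M -> (A^c)^o}).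
unshelve eexists; last by [].
by apply: (@DualBasis A M n e X) => m; rewrite -{1}[m]hP.
Qed.

(* Main.v *)
From HB Require Import structures.
Require Import Defs.
From mathcomp Require Import all_boot all_algebra boolp.
Import GRing.Theory.
Local Open Scope ring_scope.
Set Implicit Arguments.
Unset Strict Implicit.
Unset Printing Implicit Defensive.

(** The theorem rests on a retraction of comodules that the splitting sigma of
    the inclusion of S in Shat provides.

    Since M is Galois, evaluation identifies M^* (x)_S M with C, the tensor
    xi (x) m corresponding to the element xi(m_(0)) m_(1) of C, written
    [dcoef xi m]; this is [galois_ind] together with [galois_lift]. As M is
    finitely generated projective over A, M (x)_A M^* is Shat, a tensor
    y (x) xi being the rank one endomorphism x |-> y xi(x). Hence M (x)_A C is
    Shat (x)_S M, and the coaction of M becomes m |-> 1 (x) m. The map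
    sigma (x) M is therefore a left inverse r of the coaction,
      r(y (x) xi(m_(0)) m_(1)) = sigma(y xi) m,
    which is S-linear, A-linear and colinear. Symmetrically C (x)_A M^* is
    M^* (x)_S Shat, and M^* (x) sigma is a left inverse of the coaction of M^*.

    Let W be a right comodule that is finitely generated projective over A. The
    map sending f : W -> M to the colinear map w |-> r(f(w_(0)) (x) w_(1)) is
    an S-linear retraction of Hom_A(W, M) onto the colinear maps. Expanding
    w = sum_p w_p eta_p(w) in a dual basis of W, the identity of Hom^C(W, M) is
    the sum over p of the maps
      f |-> retraction of the A-linear map f(w_p) eta_p(-).
    Here f(w_p) = r(f(w_p0) (x) w_p1) because f is colinear. If w_p0 (x) w_p1
    is a sum of terms w (x) xi(m_(0)) m_(1), this equals the sum of the
    sigma(f(w) xi) m, so each of these maps is a finite sum of maps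
    f |-> sigma(f(w) xi) . h with h fixed, whose coefficient sigma(f(w) xi) in S
    depends S-linearly on f ([right_finite_rank]). The identity of
    Hom^C(W, M) thus has finite rank, that is, Hom^C(W, M) has a finite dual
    basis ([fg_projectiveP]). The statement on left comodules is proved in the
    same way. *)

(** * Maps of finite rank and finite dual bases *)

Section FiniteRank.
Variable R : pzRingType.

Definition mk_linear (X Y : lmodType R) (f : X -> Y) (fl : linear f) :
  {linear X -> Y} := HB.pack f (GRing.isLinear.Build R X Y _ f fl).

Definition finite_rank (X Y : lmodType R) (f : X -> Y) : Prop :=
  exists s : seq (Y * {linear X -> R^o}),
    forall x, f x = \sum_(p <- s) (p.2 x : R) *: p.1.

Section Closure.
Variables X Y : lmodType R.

Lemma finite_rank0 : finite_rank (fun _ : X => 0 : Y).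
Proof. by exists [::] => x; rewrite big_nil. Qed.

Lemma finite_rankD (f g : X -> Y) :
  finite_rank f -> finite_rank g -> finite_rank (fun x => f x + g x).
Proof.
by move=> [s sP] [t tP]; exists (s ++ t) => x; rewrite sP tP big_cat.
Qed.

Lemma finite_rank_sum I (r : seq I) (f : I -> X -> Y) :
  (forall i, finite_rank (f i)) -> finite_rank (fun x => \sum_(i <- r) f i x).
Proof.
move=> fP; elim: r => [|i r IHr].
  by exists [::] => x; rewrite !big_nil.
have [s sP] := finite_rankD (fP i) IHr.
by exists s => x; rewrite big_cons sP.
Qed.

Lemma finite_rank1 (t : X -> R^o) (y : Y) :
  linear t -> finite_rank (fun x => (t x : R) *: y).
Proof.
by move=> tl; exists [:: (y, mk_linear tl)] => x; rewrite big_seq1.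
Qed.
End Closure.

Lemma eq_finite_rank (X Y : lmodType R) (f g : X -> Y) :
  f =1 g -> finite_rank f -> finite_rank g.
Proof. by move=> fg [s sP]; exists s => x; rewrite -fg. Qed.

Section Rank1.
Variables X Y : lmodType R.
Implicit Types (y : Y) (t : lhom X R^o).

Definition rank1_fun y t : X -> Y := fun x => ((t : {linear X -> R^o}) x : R) *: y.

Fact rank1_lin y t : linear (rank1_fun y t).
Proof. by move=> a x x'; rewrite /rank1_fun linearP scalerDl scalerA. Qed.

Definition rank1 y t : lhom X Y := mk_linear (rank1_lin y t).

Lemma rank1Dl y y' t : rank1 (y + y') t = rank1 y t + rank1 y' t.
Proof. by apply: lin_ext => x; exact: scalerDr. Qed.

Lemma rank1Dr y t t' : rank1 y (t + t') = rank1 y t + rank1 y t'.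
Proof. by apply: lin_ext => x; exact: scalerDl. Qed.
End Rank1.

Lemma rank1_expand (P Y : lmodType R) (s : seq (P * {linear P -> R^o})) (f : lhom P Y) :
  (forall x, x = \sum_(p <- s) (p.2 x : R) *: p.1) ->
  f = \sum_(p <- s) rank1 (f p.1) p.2.
Proof.
move=> sP; apply: lin_ext => x; rewrite [in LHS](sP x) linear_sum lhom_sumE.
by apply: eq_bigr => p _; rewrite linearZ.
Qed.

(** The dual basis lemma. *)
Lemma fg_projectiveP (P : lmodType R) : fg_projective P <-> finite_rank (@id P).
Proof.
split=> [[[n [e eP]] Pproj]|[s sP]].
  pose F : lmodType R := {ffun 'I_n -> R^o}.
  pose p (a : F) : P := \sum_(i < n) (a i : R) *: e i.
  have pl : linear p.
    move=> a x y; rewrite /p scaler_sumr -big_split; apply: eq_bigr => i _ /=.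
    by rewrite !ffunE scalerDl scalerA.
  have [|h hP] := Pproj F P (mk_linear pl) idfun.
    move=> y; have [a ya] := eP y; exists [ffun i => a i].
    by rewrite /= /p ya; apply: eq_bigr => i _; rewrite ffunE.
  have hl i : linear (fun x : P => h x i : R^o).
    by move=> a x y; rewrite linearP !ffunE.
  have [s sP] := finite_rank_sum (index_enum 'I_n) (fun i => finite_rank1 (e i) (hl i)).
  by exists s => x; rewrite -sP -[LHS]hP.
split=> [|N N' g f gs].
  exists (size s), (fun i => (tnth (in_tuple s) i).1) => x.
  exists (fun i => (tnth (in_tuple s) i).2 x).
  by rewrite {1}[x]sP (big_tnth _ _ s).
(* h sends each generator p.1 to a preimage k (f p.1) of its image under f. *)
have [k kP] := boolp.choice gs.
pose h x : N := \sum_(p <- s) (p.2 x : R) *: k (f p.1).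
have hl : linear h.
  move=> a x y; rewrite /h scaler_sumr -big_split; apply: eq_bigr => p _ /=.
  by rewrite linearP scalerDl scalerA.
exists (mk_linear hl) => x /=.
rewrite [in RHS](sP x) !linear_sum; apply: eq_bigr => p _.
by rewrite !linearZ kP.
Qed.
End FiniteRank.

(** * Tensor products of bimodules *)

Section AssocInverse.
Variables (R T : pzRingType) (M : lmodType R^c) (X : bimodule R T) (N : lmodType T).

(** Coassociativity is expressed through [tassoc], but the colinearity of r has
    to be read in (M (x) C) (x) C, where r can be applied to the first factor. *)
Definition tassocV : tensor M (ltensor X N) -> tensor (rtensor M X) N :=
  tlift (fun (m : M) (v : ltensor X N) =>
    tlift (fun (x : rmod X) (n : N) => tens (tens m (x : X) : rtensor M X) n) v).

Lemma tassocV_bal1 m : balanced (fun (x : rmod X) (n : N) =>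
  tens (tens m (x : X) : rtensor M X) n).
Proof.
split=> [x x' n|x n n'|x t n]; last 1 first.
- rewrite -tens_bal; congr tens.
  by rewrite -[RHS]/(rtensor_scale t (tens m (x : X))) rtensor_scaleE.
- by rewrite -tensDl; congr tens; exact: tensDr.
- exact: tensDr.
Qed.

Lemma tassocV_bal : balanced (fun (m : M) (v : ltensor X N) =>
  tlift (fun (x : rmod X) (n : N) => tens (tens m (x : X) : rtensor M X) n) v).
Proof.
have D m := tliftD (tassocV_bal1 m); have E m := tliftE (tassocV_bal1 m).
split=> [m m' v|m v v'|m t v].
- move: v; apply: (@tens_ext _ _ _ _ _ (fun v => _ + _)) => [u v|u v|x n].
  + exact: D.
  + by rewrite !D addrACA.
  + by rewrite !E -tensDl; congr tens; exact: tensDl.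
- exact: D.
- move: v; apply: (@tens_ext _ _ _ _ _ (fun v : ltensor X N => tlift _ (t *: v)))
    => [u v|u v|x n].
  + exact: D.
  + by rewrite (@scalerDr R (ltensor X N)) D.
  + rewrite -[t *: _]/(ltensor_scale t (tens x n)) ltensor_scaleE !E.
    by congr tens; exact: tens_bal.
Qed.

Lemma tassocVE m (x : X) n :
  tassocV (tens m (tens (x : rmod X) n : ltensor X N)) =
  tens (tens m x : rtensor M X) n.
Proof. by rewrite /tassocV (tliftE tassocV_bal) (tliftE (tassocV_bal1 _)). Qed.

Lemma tassocVD : {morph tassocV : t u / t + u}.
Proof. exact: (tliftD tassocV_bal). Qed.

Lemma tassocK : cancel (@tassoc R T M X N) tassocV.
Proof.
apply: (@tens_ext _ _ _ _ _ id) => [u v|//|w n].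
  by rewrite tassocD tassocVD.
move: w; apply: (@tens_ext _ _ _ _ (fun w => tassocV (tassoc (tens (w : rtensor M X) n)))
  (fun w => tens (w : rtensor M X) n)) => [u v|u v|m x].
- by rewrite tensDl tassocD tassocVD.
- exact: tensDl.
- by rewrite tassocE tassocVE.
Qed.
End AssocInverse.

Lemma tensor_map_llin (A : pzRingType) (C : coring A) (N N' : lmodType A)
    (f : N -> N') :
  linear f -> linear (tensor_map (@id (rmod C)) f : ltensor C N -> ltensor C N').
Proof.
move=> fl; have il := @lin_id _ (rmod C).
apply: lin_intro => [u v|a u]; first exact: tensor_mapD.
have al := @scale_rlin _ _ C a; have iN := @lin_id _ N; have iN' := @lin_id _ N'.
pose sa (x : rmod C) : rmod C := a *: (x : C).
rewrite -[LHS]/(tensor_map id f (tensor_map sa id u)).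
rewrite -[RHS]/(tensor_map sa id (tensor_map id f u)).
by rewrite !tensor_map_comp.
Qed.

(** * The Galois isomorphism *)

Section Galois.
Variables (A : pzRingType) (C : coring A) (M : rcomodule C).
Local Notation S := (rcom_hom M M).
Implicit Types (y m : M) (xi zeta : dual M) (s : S) (a : A).

(** The image of y (x) xi under the identification of M (x)_A M^* with Shat. *)
Definition rank1_endo y xi : endo M := rank1 y xi.

Lemma rank1_endo_bal y a xi : rank1_endo ((a : A^c) *: y) xi = rank1_endo y (a *: xi).
Proof. by apply: lin_ext => x; exact: scalerA. Qed.

Lemma rank1_endo_compl s y xi : end_incl s * rank1_endo y xi = rank1_endo (s y) xi.
Proof. by apply: lin_ext => x; exact: (linZ _ _ (linE (rcom_fun s))). Qed.

Lemma rank1_endo_compr s y xi :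
  rank1_endo y xi * end_incl s = rank1_endo y (dual_act s xi).
Proof. by apply: lin_ext. Qed.

(** The unit of Shat is the dual basis tensor; this is why the splittings below
    undo the coactions. *)
Lemma rank1_endo_sum (b : dual_basis M) :
  \sum_(i < db_size b) rank1_endo (db_vec b i) (db_form b i) = 1.
Proof.
apply: lin_ext => x; rewrite [RHS](db_expand b x).
pose F i : lhom M M := rank1 (db_vec b i) (db_form b i).
rewrite -[LHS]/((\sum_(i < db_size b) F i : lhom M M) x).
exact: lhom_sumE.
Qed.

Lemma counit_dcoef xi m : counit (dcoef xi m) = dual_eval xi m.
Proof.
have ul : balanced (fun (x : M) (c : C) => (counit c : A^c) *: x).
  split=> [y y' c|y c c'|y a c]; first exact: scalerDr.
    by rewrite counitD; exact: scalerDl.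
  by rewrite scalerA (linZ a c (@counit_llin A C)).
rewrite /dcoef -[in RHS](rcoact_counit m).
apply: (@tens_ext _ _ _ _ (fun w => counit (contract xi w))
  (fun w => dual_eval xi (tlift _ w))) => [u v|u v|y c].
- by rewrite contractD counitD.
- by rewrite (tliftD ul); exact: linearD.
- rewrite (tliftE ul) contractE (linZ _ _ (@counit_llin A C)).
  by rewrite /dual_eval linearZ.
Qed.

Lemma dcoef_colin xi m :
  tensor_map (mk_linear (dcoef_rlin xi)) (@id C) (rcoact M m) =
  rcoact (coring_rcomodule C) (dcoef xi m).
Proof. exact: esym (comul_dcoef xi m). Qed.

Definition dcoef_hom xi : rcom_homR M (coring_rcomodule C) :=
  RComHom (N := coring_rcomodule C) (dcoef_colin xi).

Definition counit_form (f : rcom_homR M (coring_rcomodule C)) : dualR M :=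
  mk_linear (lin_comp (@counit_rlin A C) (linE (rcom_fun f))).

(** Together with [counit_dcoef], this identifies Hom^C(M, C) with M^*: a
    colinear map into C is recovered from its composite with the counit, by
    colinearity and the counit axiom. *)
Lemma dcoef_counit_form f m : dcoef (counit_form f) m = f m.
Proof.
have cb : balanced (fun (x : rmod C) (c : C) => counit (x : C) *: c).
  split=> [c c' x|c x x'|c a x]; last first.
  - by rewrite scalerA (@linZ A^c (rmod C) (A^c)^o _ a c (@counit_rlin A C)).
  - exact: scalerDr.
  - by rewrite counitD scalerDl.
have fl := linE (rcom_fun f); have il := @lin_id A C.
rewrite -[RHS](comul_counitl (f m : C)).
rewrite -[comul _]/(rcoact (coring_rcomodule C) (f m)) -rcom_funP /dcoef.
apply: (@tens_ext _ _ _ _ _ (fun u => tlift _ (tensor_map f id u)))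
  => [u v|u v|x c].
- exact: contractD.
- by rewrite tensor_mapD // (tliftD cb).
- by rewrite tensor_mapE // (tliftE cb) contractE.
Qed.

Hypothesis Mfg : fg_projective M.
Hypothesis gal : rcom_iso (galois_map M).

(** Surjectivity of the Galois map. *)
Lemma galois_ind (P : C -> Prop) :
  P 0 -> (forall c d, P c -> P d -> P (c + d)) ->
  (forall xi m, P (dcoef xi m)) -> forall c, P c.
Proof.
have [g [_ gK]] := gal; move=> P0 PD Pd c; rewrite -[c](gK c).
move: (g c); apply: tens_ind => [|t u|f m].
- by rewrite (lin0 (linE (rcom_fun (galois_map M)))).
- by rewrite (linD (linE (rcom_fun (galois_map M)))); exact: PD.
- by rewrite /= galois_funE -dcoef_counit_form.
Qed.

Lemma galois_ext (G : zmodType) (f g : C -> G) :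
  {morph f : c d / c + d} -> {morph g : c d / c + d} ->
  (forall xi m, f (dcoef xi m) = g (dcoef xi m)) -> f =1 g.
Proof.
move=> fD gD fg; apply: galois_ind => [|c d fc gd|//].
  have f0 : f 0 = 0 by apply: (addIr (f 0)); rewrite -fD !add0r.
  by rewrite f0; apply: (addIr (g 0)); rewrite -gD !add0r.
by rewrite fD gD fc gd.
Qed.

(** Injectivity of the Galois map, in the form of a universal property of C: an
    additive map on C is defined by a formula in xi and m that is balanced over
    S. *)
Lemma galois_lift (G : zmodType) (b : dualR M -> lendmod M -> G) :
  balanced b -> exists phi : C -> G,
    {morph phi : c d / c + d} /\ forall xi m, phi (dcoef xi m) = b xi m.
Proof.
have [g [Kg gK]] := gal; move=> bP; have [bDl bDr bB] := bP.
pose b' (f : rcom_homR M (coring_rcomodule C)) (m : lend_bimod M) := b (counit_form f) m.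
have b'P : balanced b'.
  split=> [f f' m|f m m'|f s m]; rewrite /b'.
  - rewrite -bDl; congr b; apply: lin_ext => x; exact: (counitD (f x : C) (f' x : C)).
  - exact: bDr.
  - rewrite -bB; congr b; exact: lin_ext.
exists (fun c => tlift b' (g c)); split=> [c d|xi m].
  by rewrite (linD (linE (rcom_fun g))) (tliftD b'P).
have -> : dcoef xi m = galois_map M (tens (dcoef_hom xi) (m : lend_bimod M)).
  by rewrite /= galois_funE.
rewrite Kg (tliftE b'P) /b'; congr b; apply: lin_ext => x.
exact: counit_dcoef.
Qed.
(** * The splittings of the coactions of M and of its dual *)

Variable sigma : {additive endo M -> S}.
Hypothesis sigma_l : forall s x, sigma (end_incl s * x) = s * sigma x.
Hypothesis sigma_r : forall x s, sigma (x * end_incl s) = sigma x * s.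
Hypothesis sigma1 : sigma 1 = 1.

(** This is sigma (x) M on Shat (x)_S M = M (x)_A C. It is
    balanced over S because sigma is right S-linear. *)
Lemma right_splitting : exists r : {linear rtensor M C -> M},
  forall y xi m, r (tens y (dcoef xi m)) = sigma (rank1_endo y xi) m.
Proof.
have bP y : balanced (fun (xi : dualR M) (m : lendmod M) =>
    sigma (rank1_endo y xi) m : M).
  split=> [xi xi' m|xi m m'|xi s m].
  - by rewrite /rank1_endo rank1Dr raddfD.
  - exact: linearD.
  - by rewrite -[(s : S^c) *: xi]/(dual_act s xi) -rank1_endo_compr sigma_r.
have [theta thP] := boolp.choice (fun y => galois_lift (bP y)).
have thD y := (thP y).1; have thE y := (thP y).2.
have tb : balanced (fun (y : M) (c : C) => theta y c).
  split=> [y y' c|y c c'|y a c]; last 1 first.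
  - move: c; apply: galois_ext => [c d|c d|xi m]; first exact: thD.
      by rewrite scalerDr thD.
    by rewrite -(linZ _ _ (dcoef_llin m)) !thE rank1_endo_bal.
  - move: c; apply: (galois_ext (g := fun c => _ + _))
      => [c d|c d|xi m]; first exact: thD.
      by rewrite !thD addrACA.
    by rewrite !thE /rank1_endo rank1Dl raddfD.
  - exact: thD.
have rl : linear (tlift (fun (y : M) (c : C) => theta y c) : rtensor M C -> M).
  apply: lin_intro => [|a]; first exact: (tliftD tb).
  apply: (@tens_ext _ _ _ _ (fun u => tlift _ ((a : A^c) *: (u : rtensor M C)))
    (fun u => (a : A^c) *: tlift _ u)) => [u v|u v|y c].
  - by rewrite (@scalerDr A^c (rtensor M C)) (tliftD tb).
  - by rewrite (tliftD tb) scalerDr.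
  - rewrite -[X in tlift _ X]/(rtensor_scale a (tens y c)) rtensor_scaleE !(tliftE tb).
    move: c; apply: (galois_ext (f := fun c => theta y (ract c a))
      (g := fun c => (a : A^c) *: theta y c)) => [c d|c d|xi m].
    + by rewrite ractDl thD.
    + by rewrite thD scalerDr.
    + rewrite -[ract _ _]/((a : A^c) *: (dcoef xi m : rmod C)).
      by rewrite -(linZ _ _ (dcoef_rlin xi)) !thE linearZ.
by exists (mk_linear rl) => y xi m; rewrite -thE -(tliftE tb).
Qed.

(** This is M^* (x) sigma on M^* (x)_S Shat = C (x)_A M^*, which requires sigma to
    be left S-linear. *)
Lemma left_splitting : exists r : {linear ltensor C (dual M) -> dual M},
  forall xi m zeta, r (tens (dcoef xi m : rmod C) zeta) =
    dual_act (sigma (rank1_endo m zeta)) xi.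
Proof.
have bP zeta : balanced (fun (xi : dualR M) (m : lendmod M) =>
    dual_act (sigma (rank1_endo m zeta)) xi : dual M).
  split=> [xi xi' m|xi m m'|xi s m].
  - exact: lin_ext.
  - by rewrite /rank1_endo rank1Dl raddfD; apply: lin_ext => x; exact: (linearD xi).
  - by rewrite -[s *: m]/(s (m : M)) -rank1_endo_compl sigma_l; exact: lin_ext.
have [theta thP] := boolp.choice (fun zeta => galois_lift (bP zeta)).
have thD zeta := (thP zeta).1; have thE zeta := (thP zeta).2.
have tb : balanced (fun (c : rmod C) (zeta : dual M) => theta zeta c).
  split=> [c d zeta|c zeta zeta'|c a zeta].
  - exact: thD.
  - move: c; apply: (galois_ext (g := fun c => _ + _))
      => [c d|c d|xi m]; first exact: thD.
      by rewrite !thD addrACA.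
    rewrite !thE /rank1_endo rank1Dr raddfD; apply: lin_ext => x; exact: (linearD xi).
  - move: c; apply: (galois_ext (f := fun c : C => theta zeta (ract c a)))
      => [c d|c d|xi m].
    + by rewrite ractDl thD.
    + exact: thD.
    + rewrite -[ract _ _]/((a : A^c) *: (dcoef xi m : rmod C)).
      by rewrite -(linZ _ _ (dcoef_rlin xi)) !thE rank1_endo_bal.
have rl : linear (tlift (fun (c : rmod C) (zeta : dual M) => theta zeta c) :
    ltensor C (dual M) -> dual M).
  apply: lin_intro => [|a]; first exact: (tliftD tb).
  apply: (@tens_ext _ _ _ _ (fun u => tlift _ (a *: (u : ltensor C (dual M))))
    (fun u => a *: (tlift _ u : dual M))) => [u v|u v|c zeta].
  - by rewrite (@scalerDr A (ltensor C (dual M))) (tliftD tb).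
  - by rewrite (tliftD tb) scalerDr.
  - rewrite -[X in tlift _ X]/(ltensor_scale a (tens c zeta)) ltensor_scaleE !(tliftE tb).
    move: c; apply: (galois_ext (f := fun c : C => theta zeta (a *: c))
      (g := fun c => a *: theta zeta c)) => [c d|c d|xi m].
    + by rewrite scalerDr thD.
    + by rewrite thD scalerDr.
    + by rewrite -(linZ _ _ (dcoef_llin m)) !thE (linZ _ _ (dual_act_lin _)).
by exists (mk_linear rl) => xi m zeta; rewrite -thE -(tliftE tb).
Qed.
(** * Colinear maps into M *)

Section Right.
Variable r : {linear rtensor M C -> M}.
Hypothesis rE : forall y xi m, r (tens y (dcoef xi m)) = sigma (rank1_endo y xi) m.

Lemma right_splitting_coact m : r (rcoact M m) = m.
Proof.
have [b _] : exists b : dual_basis M, True := fg_projective_dual_basis Mfg.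
have -> : rcoact M m = \sum_(i < db_size b) tens (db_vec b i) (dcoef (db_form b i) m).
  rewrite /dcoef; move: (rcoact M m).
  apply: (@tens_ext _ _ _ _ id (fun u => \sum_(i < db_size b) _)) => [//|u v|y c].
    by rewrite -big_split; apply: eq_bigr => i _ /=; rewrite contractD tensDr.
  rewrite [in LHS](db_expand b y) tens_suml; apply: eq_bigr => i _.
  by rewrite contractE tens_bal.
rewrite linear_sum -[RHS]/((1 : S) m) -sigma1 -(rank1_endo_sum b) raddf_sum.
rewrite (@morphD_sum S M (fun s : S => s m)) //.
by apply: eq_bigr => i _; exact: rE.
Qed.

Lemma right_splitting_scale s u : r (tensor_map s id u) = s (r u).
Proof.
have sl := linE (rcom_fun s); have il := @lin_id A C.
move: u; apply: (@tens_ext _ _ _ _ (fun u => r (tensor_map s id u)) (fun u => s (r u)))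
  => [u v|u v|y c].
- by rewrite tensor_mapD // linearD.
- by rewrite !linearD.
rewrite tensor_mapE //; move: c.
apply: (galois_ext (f := fun c => r (tens (s y) c)) (g := fun c => s (r (tens y c))))
  => [c d|c d|xi m].
- by rewrite tensDr linearD.
- by rewrite tensDr !linearD.
by rewrite !rE -rank1_endo_compl sigma_l.
Qed.

(** On Shat (x)_S M the coaction is that of the factor M, and sigma(y xi), being
    an element of S, commutes with it. *)
Lemma right_splitting_colin u :
  rcoact M (r u) = tensor_map r (@id C)
    (tassocV (tensor_map id (@comul A C : C -> ltensor C C) u)).
Proof.
have rl := linE r; have il := @lin_id A C; have iM := @lin_id _ M.
have cl := @comul_llin A C.
move: u; apply: (@tens_ext _ _ _ _ (fun u => rcoact M (r u))
  (fun u => tensor_map r (@id C)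
    (tassocV (tensor_map id (@comul A C : C -> ltensor C C) u)))) => [u v|u v|y c].
- by rewrite !linearD.
- by rewrite tensor_mapD // tassocVD tensor_mapD.
rewrite tensor_mapE //; move: c.
apply: (galois_ext (f := fun c => rcoact M (r (tens y c)))
  (g := fun c => tensor_map r (@id C) (tassocV (tens y (comul c : ltensor C C)))))
  => [c d|c d|xi m].
- by rewrite tensDr !linearD.
- rewrite comulD.
  by rewrite (tensDr y (comul c : ltensor C C)) tassocVD tensor_mapD.
rewrite rE -rcom_funP comul_dcoef.
move: (rcoact M m); set s := sigma _.
have sl := linE (rcom_fun s); have dl := dcoef_rlin xi.
apply: (@tens_ext _ _ _ _ _ (fun u => tensor_map r id (tassocV (tens y
    (tensor_map (dcoef xi : M -> rmod C) (@id C) u : ltensor C C)))))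
  => [u v|u v|x c].
- exact: tensor_mapD.
- by rewrite tensor_mapD // (tensDr y (_ : ltensor C C)) tassocVD tensor_mapD.
- by rewrite !tensor_mapE // tassocVE tensor_mapE // rE.
Qed.

Section Retraction.
Variable W : rcomodule C.

(** Sends f to the composite of f (x) C with the coaction of W and r. By adjunction
    f corresponds to a colinear map W -> M (x) C, and r is colinear. *)
Definition rcolin_fun (f : lhom W M) : W -> M :=
  fun w => r (tensor_map (f : {linear W -> M}) (@id C) (rcoact W w)).

Fact rcolin_lin f : linear (rcolin_fun f).
Proof.
apply: lin_comp (linE r) _; apply: lin_comp (linE (rcoact W)).
exact: tensor_map_rlin (linE (f : {linear W -> M})).
Qed.

Fact rcolin_subproof f w :
  tensor_map (mk_linear (rcolin_lin f)) (@id C) (rcoact W w) =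
  rcoact M (mk_linear (rcolin_lin f) w).
Proof.
have fl := linE (f : {linear W -> M}); have Wl := linE (rcoact W).
have il := @lin_id A C; have rl := linE r.
have tl : linear (tensor_map f (@id C) : rtensor W C -> rtensor M C).
  exact: tensor_map_rlin.
have iW := @lin_id _ W; have iM := @lin_id _ M; have cl := @comul_llin A C.
rewrite /= /rcolin_fun right_splitting_colin.
have -> : tensor_map id (@comul A C : C -> ltensor C C)
      (tensor_map (f : {linear W -> M}) (@id C) (rcoact W w)) =
    tensor_map (f : {linear W -> M}) (@id (ltensor C C))
      (tassoc (tensor_map (rcoact W) id (rcoact W w))).
  by rewrite rcoact_coassoc !tensor_map_comp.
rewrite -(@tassoc_map _ _ _ _ C C _ _ f (tensor_map f (@id C)) id id id id) //
  => [|u]; last by rewrite tensor_map_id.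
by rewrite tassocK !tensor_map_comp //; exact: lin_comp.
Qed.

Definition rcolin f : rcom_hom W M := RComHom (rcolin_subproof f).

Lemma rcolinD f g : rcolin (f + g) = rcolin f + rcolin g.
Proof.
apply: rcom_ext => w /=; rewrite -linearD; congr (r _).
exact: (tensor_mapDl (f : {linear W -> M}) g idfun).
Qed.

(** For f colinear, r undoes the coaction of M that f turns the coaction of W
    into. *)
Lemma rcolin_id (f : rcom_hom W M) : rcolin (rcom_fun f) = f.
Proof.
by apply: rcom_ext => w; rewrite /= /rcolin_fun rcom_funP right_splitting_coact.
Qed.

Lemma rcolin_rank1_lin (t : dual W) :
  linear (fun y : lendmod M => rcolin (rank1 (y : M) t)).
Proof.
apply: lin_intro => [y y'|s y]; first by rewrite -rcolinD -rank1Dl.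
apply: rcom_ext => w /=; rewrite -right_splitting_scale; congr (r _).
have tl := rank1_lin (y : M) t; have sl := linE (rcom_fun s).
have il := @lin_id _ C; rewrite tensor_map_comp //.
apply: tensor_map_ext => // x; exact: esym (linZ _ _ (linE (rcom_fun s))).
Qed.

(** The map depends additively on u, so u may be taken of the form
    w (x) xi(m_(0)) m_(1); the value is then sigma(f(w) xi) F(m). *)
Lemma right_finite_rank (X : lmodType S) (F : lendmod M -> X) (u : tensor W C) :
  linear F ->
  finite_rank (fun f : rcom_hom W M => F (r (tensor_map f (@id C) u))).
Proof.
move=> Fl; have il := @lin_id A C.
move: u; apply: tens_ind => [|u v uP vP|w].
- apply: eq_finite_rank (finite_rank0 _ _) => f.
  rewrite (lin0 (tensor_map_rlin (linE (rcom_fun f)))) (lin0 (linE r)).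
  by rewrite (lin0 Fl).
- apply: eq_finite_rank (finite_rankD uP vP) => f.
  have fl := linE (rcom_fun f).
  by rewrite tensor_mapD // linearD; exact: esym (linD Fl _ _).
apply: galois_ind => [|c d cP dP|xi m].
- apply: eq_finite_rank (finite_rank0 _ _) => f; rewrite tens0r.
  rewrite (lin0 (tensor_map_rlin (linE (rcom_fun f)))) (lin0 (linE r)).
  by rewrite (lin0 Fl).
- apply: eq_finite_rank (finite_rankD cP dP) => f.
  have fl := linE (rcom_fun f).
  by rewrite tensDr tensor_mapD // linearD; exact: esym (linD Fl _ _).
have tl : linear (fun f : rcom_hom W M => sigma (rank1_endo (f w) xi) : S^o).
  apply: lin_intro => [f g|s f]; first by rewrite /rank1_endo rank1Dl raddfD.
  by rewrite -[(s *: f) w]/(s (f w)) -rank1_endo_compl sigma_l.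
apply: eq_finite_rank (finite_rank1 (F (m : lendmod M)) tl) => f.
have fl := linE (rcom_fun f).
by rewrite tensor_mapE // rE -(linZ _ _ Fl).
Qed.

(** Expanding f in a dual basis of W turns the identity f |-> rcolin f into a sum
    of maps of finite rank. *)
Lemma right_fg_projective : fg_projective W -> fg_projective (rcom_hom W M).
Proof.
move=> /fg_projectiveP[s sP]; apply/fg_projectiveP.
have phi_rank (p : W * {linear W -> (A^c)^o}) :=
  right_finite_rank (rcoact W p.1) (rcolin_rank1_lin p.2).
apply: eq_finite_rank (finite_rank_sum s phi_rank) => f.
rewrite -[RHS]rcolin_id [in RHS](rank1_expand (rcom_fun f) sP).
rewrite (morphD_sum rcolinD); apply: eq_bigr => p _.
by rewrite rcom_funP right_splitting_coact.
Qed.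
End Retraction.
End Right.

(** * Colinear maps into the dual of M *)

Section Left.
Variable b : dual_basis M.
Local Notation Md := (dual_comodule b).
Variable r : {linear ltensor C (dual M) -> dual M}.
Hypothesis rE : forall xi m zeta, r (tens (dcoef xi m : rmod C) zeta) =
  dual_act (sigma (rank1_endo m zeta)) xi.

Lemma dual_actDl (zeta : dual M) : {morph (fun s : S => dual_act s zeta) : s t / s + t}.
Proof. by move=> s t; apply: lin_ext => x; exact: (linearD zeta). Qed.

Lemma left_splitting_coact zeta : r (dcoact b zeta) = zeta.
Proof.
rewrite /dcoact linear_sum.
transitivity (dual_act
  (sigma (\sum_(i < db_size b) rank1_endo (db_vec b i) (db_form b i))) zeta).
  rewrite raddf_sum (morphD_sum (dual_actDl zeta)).
  by apply: eq_bigr => i _; exact: rE.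
by rewrite rank1_endo_sum sigma1; exact: lin_ext.
Qed.

Lemma left_splitting_scale s u :
  r (tensor_map id (dual_act s) u) = dual_act s (r u).
Proof.
have sl := dual_act_lin s; have il := @lin_id _ (rmod C).
move: u; apply: (@tens_ext _ _ _ _ (fun u => r (tensor_map id (dual_act s) u))
  (fun u => dual_act s (r u))) => [u v|u v|c zeta].
- by rewrite tensor_mapD // linearD.
- by rewrite linearD (linD sl).
rewrite tensor_mapE //; move: c.
apply: (galois_ext (f := fun c : C => r (tens (c : rmod C) (dual_act s zeta)))
   (g := fun c : C => dual_act s (r (tens (c : rmod C) zeta)))) => [c d|c d|xi m].
- by rewrite tensDl linearD.
- by rewrite tensDl linearD (linD sl).
by rewrite !rE -rank1_endo_compr sigma_r; exact: lin_ext.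
Qed.

(** The elements xi(m_(0)) m_(1) are comultiplied through the dual basis b, which
    leaves the factor of M^* to be acted on by sigma(m zeta); this action is
    colinear by [dcoact_act]. *)
Lemma left_splitting_colin u :
  dcoact b (r u) = tensor_map (@id (rmod C)) r
    (tassoc (tensor_map (@comul A C : rmod C -> rtensor (rmod C) C) id u)).
Proof.
have rl := linE r; have il := @lin_id _ (rmod C); have iM := @lin_id _ (dual M).
have cl := @comul_rlin A C; have dl := @dcoact_lin A C M b.
move: u; apply: (@tens_ext _ _ _ _ (fun u => dcoact b (r u)) (fun u => tensor_map id r
    (tassoc (tensor_map (@comul A C : rmod C -> rtensor (rmod C) C) id u))))
  => [u v|u v|c zeta].
- by rewrite !linearD.
- by rewrite tensor_mapD // tassocD tensor_mapD.
rewrite tensor_mapE //; move: c.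
apply: (galois_ext (f := fun c : C => dcoact b (r (tens (c : rmod C) zeta)))
  (g := fun c : C => tensor_map (@id (rmod C)) r
    (tassoc (tens (comul c : rtensor (rmod C) C) zeta))))
  => [c d|c d|xi m].
- by rewrite tensDl !linearD.
- by rewrite comulD (tensDl (comul c : rtensor (rmod C) C)) tassocD tensor_mapD.
rewrite rE -dcoact_act comul_dcoef (dcoef_expand b).
rewrite (@tens_suml _ (rtensor (rmod C) C)) (morphD_sum (@tassocD _ _ _ _ _)).
rewrite (morphD_sum (tensor_mapD il rl)).
rewrite /dcoact (morphD_sum (tensor_mapD il (dual_act_lin _))).
apply: eq_bigr => i _.
have sl := dual_act_lin (sigma (rank1_endo m zeta)).
by rewrite tassocE !tensor_mapE // rE.
Qed.

Section Retraction.
Variable V : lcomodule C.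

Definition lcolin_fun (f : lhom V (dual M)) : V -> Md :=
  fun v => r (tensor_map (@id (rmod C)) (f : {linear V -> dual M}) (lcoact V v)).

Fact lcolin_lin f : linear (lcolin_fun f).
Proof.
apply: lin_comp (linE r) _; apply: lin_comp (linE (lcoact V)).
exact: tensor_map_llin (linE (f : {linear V -> dual M})).
Qed.

Fact lcolin_subproof f v :
  tensor_map (@id (rmod C)) (mk_linear (lcolin_lin f)) (lcoact V v) =
  lcoact Md (mk_linear (lcolin_lin f) v).
Proof.
have fl := linE (f : {linear V -> dual M}); have Vl := linE (lcoact V).
have il := @lin_id _ (rmod C); have rl := linE r.
have tl : linear (tensor_map (@id (rmod C)) f : ltensor C V -> ltensor C (dual M)).
  exact: tensor_map_llin.
have iV := @lin_id _ V; have iM := @lin_id _ (dual M); have cl := @comul_rlin A C.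
rewrite /= /lcolin_fun left_splitting_colin.
have -> : tensor_map (@comul A C : rmod C -> rtensor (rmod C) C) id
      (tensor_map (@id (rmod C)) (f : {linear V -> dual M}) (lcoact V v)) =
    tensor_map (@id (rtensor (rmod C) C)) (f : {linear V -> dual M})
      (tensor_map (@comul A C : rmod C -> rtensor (rmod C) C) id (lcoact V v)).
  by rewrite !tensor_map_comp.
rewrite (@tassoc_map _ _ _ _ C C _ _ id id (tensor_map id f) id id f) //
  => [|u]; last by rewrite tensor_map_id.
rewrite lcoact_coassoc !tensor_map_comp //; exact: lin_comp.
Qed.

Definition lcolin f : lcom_hom_dual V b := LComHom (W := Md) (lcolin_subproof f).

Lemma lcolinD f g : lcolin (f + g) = lcolin f + lcolin g.
Proof.
apply: lcom_ext => w /=; rewrite -linearD; congr (r _).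
exact: (tensor_mapDr idfun (f : {linear V -> dual M}) g).
Qed.

Lemma lcolin_id (f : lcom_hom V Md) : lcolin (lcom_fun f) = f.
Proof.
apply: lcom_ext => v; rewrite /= /lcolin_fun.
by rewrite -[RHS]left_splitting_coact -[dcoact b _](lcom_funP f).
Qed.

Lemma lcolin_rank1_lin (t : {linear V -> A^o}) :
  linear (fun zeta : dualR M => lcolin (rank1 (zeta : dual M) t)).
Proof.
apply: lin_intro => [y y'|s y]; first by rewrite -lcolinD -rank1Dl.
apply: lcom_ext => v.
rewrite -[RHS]/(dual_act s (r (tensor_map id (rank1 (y : dual M) t) (lcoact V v)))).
rewrite /= -left_splitting_scale; congr (r _).
have tl := rank1_lin (y : dual M) t; have sl := dual_act_lin s.
have il := @lin_id _ (rmod C); rewrite tensor_map_comp //.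
apply: tensor_map_ext => // x; exact: esym (linZ _ _ (dual_act_lin s)).
Qed.

(** For u of the form xi(m_(0)) m_(1) (x) v the value is F(xi) acted on by
    sigma(m f(v)). *)
Lemma left_finite_rank (X : lmodType S^c) (F : dualR M -> X) (u : tensor (rmod C) V) :
  linear F ->
  finite_rank (fun f : lcom_hom_dual V b => F (r (tensor_map (@id (rmod C)) f u))).
Proof.
move=> Fl; have il := @lin_id _ (rmod C).
have F0 : F (r 0) = 0 by rewrite (lin0 (linE r)); exact: lin0 Fl.
have tf0 (f : lcom_hom_dual V b) : tensor_map (@id (rmod C)) f 0 = 0.
  exact: (lin0 (tensor_map_llin (linE (lcom_fun f)))).
move: u; apply: tens_ind => [|u v uP vP|c v].
- by apply: eq_finite_rank (finite_rank0 _ _) => f; rewrite tf0 F0.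
- apply: eq_finite_rank (finite_rankD uP vP) => f.
  have fl := linE (lcom_fun f).
  by rewrite tensor_mapD // linearD; exact: esym (linD Fl _ _).
move: c; apply: (galois_ind (P := fun c : C => finite_rank (fun f : lcom_hom_dual V b =>
  F (r (tensor_map (@id (rmod C)) f (tens (c : rmod C) v)))))) => [|c d cP dP|xi m].
- by apply: eq_finite_rank (finite_rank0 _ _) => f; rewrite tens0l tf0 F0.
- apply: eq_finite_rank (finite_rankD cP dP) => f.
  have fl := linE (lcom_fun f).
  by rewrite tensDl tensor_mapD // linearD; exact: esym (linD Fl _ _).
have tl : linear (fun f : lcom_hom_dual V b => sigma (rank1_endo m (f v)) : (S^c)^o).
  apply: lin_intro => [f g|s f]; first by rewrite /rank1_endo rank1Dr raddfD.
  by rewrite -[(s *: f) v]/(dual_act s (f v)) -rank1_endo_compr sigma_r.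
apply: eq_finite_rank (finite_rank1 (F (xi : dualR M)) tl) => f.
have fl := linE (lcom_fun f).
by rewrite tensor_mapE // rE -(linZ _ _ Fl).
Qed.

Lemma left_fg_projective : fg_projective V -> fg_projective (lcom_hom_dual V b).
Proof.
move=> /fg_projectiveP[s sP]; apply/fg_projectiveP.
have phi_rank (p : V * {linear V -> A^o}) :=
  left_finite_rank (lcoact V p.1) (lcolin_rank1_lin p.2).
apply: eq_finite_rank (finite_rank_sum s phi_rank) => f.
rewrite -[RHS]lcolin_id [in RHS](rank1_expand (lcom_fun f) sP).
rewrite (morphD_sum lcolinD); apply: eq_bigr => p _.
by rewrite (lcom_funP f) left_splitting_coact.
Qed.
End Retraction.
End Left.
End Galois.

(** * Finitely generated projective modules of colinear maps *)

Theorem proposition7p4 (k : fieldType) (A : pzRingType)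
    (eta : {rmorphism k -> A}) (eta_central : forall x a, eta x * a = a * eta x)
    (C : coring A) (M : rcomodule C) (M_galois : galois M)
    (S_split : split_extension (@end_incl A C M)) :
  (projective (dualR M) -> flat_left C ->
     forall V : lcomodule C, fg_projective V ->
     forall b : dual_basis M, fg_projective (lcom_hom_dual V b)) /\
  (projective (lendmod M) -> flat_right (rmod C) ->
     forall W : rcomodule C, fg_projective W -> fg_projective (rcom_hom W M)).
Proof.
have [Mfg gal] := M_galois; have [sigma [sigma_l sigma_r sigma1]] := S_split.
split=> _ _ => [V Vfg b|W Wfg].
  have [r rE] := left_splitting gal sigma_l.
  exact: (left_fg_projective gal sigma_r sigma1 b rE Vfg).
have [r rE] := right_splitting gal sigma_r.
exact: (right_fg_projective Mfg gal sigma_l sigma1 rE Wfg).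
Qed.
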